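(* Let $w\in\widetilde{\Sigma}_n$ be an affine permutation. Then $$\widetilde{G}_w(x)=\sum_{T}(-1)^{|T|-\ell(w)}x^T,$$ where the sum is over all column-strict set-valued balanced labellings $T$ of $D(w)$, $x^T$ is the monomial $\prod_{b\in[D(w)]}\prod_{k\in T(b)}x_k$, and $\widetilde{G}_w$ is the affine stable Grothendieck polynomial of $w$.
   Context: Let $n\ge 2$. The affine symmetric group $\widetilde{\Sigma}_n$ is the group of bijections $w:\mathbb{Z}\to\mathbb{Z}$ with $w(i+n)=w(i)+n$ and $\sum_{i=1}^n w(i)=n(n+1)/2$. It is generated by $s_i$ ($i\in\mathbb{Z}/n\mathbb{Z}$), where $s_i$ interchanges $kn+i$ and $kn+i+1$ for all $k\in\mathbb{Z}$; $\ell(w)$ is the minimal length of a word in the $s_i$ representing $w$, and words of minimal length are reduced. The affine nilHecke algebra $\widetilde{\mathcal{U}}_n$ is the associative unital ring that is a free $\mathbb{Z}$-module with basis $\{u_w : w\in\widetilde{\Sigma}_n\}$, with $u_i:=u_{s_i}$ and $u_iu_w=u_{s_iw}$ if $\ell(s_iw)>\ell(w)$, $u_iu_w=u_w$ otherwise (so $u_i^2=u_i$ and the $u_i$ satisfy the braid and commutation relations of the $s_i$). A word with letters in $\mathbb{Z}/n\mathbb{Z}$ is cyclically decreasing if each letter appears at most once and, whenever $i$ and $i+1$ both appear, $i+1$ precedes $i$. An affine permutation is cyclically decreasing if it has a cyclically decreasing reduced word. A cyclically decreasing nilHecke factorization $\alpha$ of $w$ is a factorization $u_w=u_{v_1}u_{v_2}\cdots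 u_{v_k}$ with each $v_i$ cyclically decreasing (identity factors are allowed, and factorizations differing only by trailing identity factors are identified); $|\alpha|:=\ell(v_1)+\cdots+\ell(v_k)$. The affine stable Grothendieck polynomial is the formal power series $\widetilde{G}_w(x)=\sum_\alpha(-1)^{|\alpha|-\ell(w)}x_1^{\ell(v_1)}x_2^{\ell(v_2)}\cdots x_k^{\ell(v_k)}$, the sum over all cyclically decreasing nilHecke factorizations of $w$. $D(w)=\{(i,w(j)) : i<j,\ w(i)>w(j)\}\subseteq\mathbb{Z}\times\mathbb{Z}$; elements are boxes, with the first coordinate the row (increasing southward) and the second the column (increasing eastward). $D(w)$ is invariant under translation by $(n,n)$; $[D(w)]$ is the set of boxes in rows $1,\dots,n$. A set-valued (s-v) labelling of $D(w)$ is a map $T$ from $D(w)$ to nonempty finite subsets of $\mathbb{Z}_{>0}$ with $T(i,j)=T(i+n,j+n)$; $|T|=\sum_{b\in[D(w)]}|T(b)|$. $T$ is column-strict if $T(a)\cap T(b)=\emptyset$ for any two distinct boxes $a,b$ in the same column. Balancedness: for a box $a$ of a (sub)diagram, its hook $H_a$ consists of $a$, the boxes $b_i$ to the right of $a$ in its row, and the boxes $c_j$ below $a$ in its column. Let $\mathrm{rmin}_a=\min\bigcup_iT(b_i)$, $\mathrm{bmin}_a=\min\bigcup_jT(c_j)$, with $\min\emptyset=\infty$. From each box of $H_a$ one may pick one label as follows: from $a$, any element of $T(a)$; from $b_i$, either $\min T(b_i)$ or any $x\in T(b_i)$ with $x\le\mathrm{bmin}_a$; from $c_j$, either $\min T(c_j)$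 or any $y\in T(c_j)$ with $y\le\mathrm{rmin}_a$. $H_a$ is balanced if for every such choice of one label in each box, the resulting single-valued hook is balanced: rearranging its labels so that they weakly increase from right to left along the row part and then from top to bottom along the column part leaves the corner label (that of $a$) unchanged. $T$ is balanced if for all integers $i<j<k$, in the subdiagram of $D(w)$ consisting of its boxes in rows $i,j,k$ and columns $w(i),w(j),w(k)$ (with the restriction of $T$), every hook is balanced, hooks being taken within this subdiagram.
   Formalization: In the definition of a balanced hook, a non-minimal label x of a box b_i to the right of a may be picked only if x < bmin_a (strictly) instead of x ≤ bmin_a; with ≤ the identity fails for n=3, w=321 at x_1^2 x_2^2 (coefficient -1 versus 0). *)

(* Defs.v *)
From HB Require Import structures.
From mathcomp Require Import all_boot all_order all_algebra.
From mathcomp Require Import finmap monalg.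
From mathcomp Require Import all_classical.

Set Implicit Arguments.
Unset Strict Implicit.
Unset Printing Implicit Defensive.

Import Order.TTheory GRing.Theory Num.Theory.

Local Open Scope ring_scope.
Local Open Scope classical_set_scope.

(* Affine permutations are plain functions [int -> int] satisfying the
   predicate [affine_perm n]; the group law is composition, [s \o w]. *)

Definition affine_perm (n : nat) : set (int -> int) :=
  [set w | [/\ bijective w,
               forall i, w (i + n%:Z) = w i + n%:Z &
               \sum_(1 <= i < n.+1) w i%:Z = (n * n.+1 %/ 2)%N%:Z]].

(* Everything below is meant for [2 <= n], where ['Z_n] is Z/nZ. *)
Definition sgen (n : nat) (i : 'Z_n) (x : int) : int :=
  if (x == (i : nat)%:Z %[mod n%:Z])%Z then x + 1
  else if (x == (i : nat)%:Z + 1 %[mod n%:Z])%Z then x - 1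
  else x.

(* The word [:: i1; ...; il] represents s_i1 s_i2 ... s_il. *)
Definition word_perm (n : nat) (a : seq 'Z_n) : int -> int :=
  foldr (fun i w => sgen i \o w) id a.

Definition reduced_word (n : nat) (w : int -> int) : set (seq 'Z_n) :=
  [set a | word_perm a = w /\
           forall b : seq 'Z_n, word_perm b = w -> (size a <= size b)%N].

(* The value 0 for functions outside the group is irrelevant. *)
Definition len (n : nat) (w : int -> int) : nat :=
  xget 0%N [set size a | a in @reduced_word n w].

(* [u] exhibits [U] as the affine nilHecke algebra.  This determines the pair
   (U, u) up to unique isomorphism; [u] is unconstrained off [affine_perm n]. *)
Record affine_nilHecke (n : nat) (U : pzRingType) (u : (int -> int) -> U) :
    Prop := AffineNilHecke {
  nilHecke_free : forall (ws : seq (int -> int)) (c : (int -> int) -> int),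
    uniq ws -> (forall w, w \in ws -> affine_perm n w) ->
    \sum_(w <- ws) u w *~ c w = 0 -> forall w, w \in ws -> c w = 0;
  nilHecke_span : forall x : U,
    exists (ws : seq (int -> int)) (c : (int -> int) -> int),
      (forall w, w \in ws -> affine_perm n w) /\
      x = \sum_(w <- ws) u w *~ c w;
  nilHecke_one : u id = 1;
  nilHecke_mul : forall (i : 'Z_n) (w : int -> int), affine_perm n w ->
    u (sgen i) * u w =
      if (len n w < len n (sgen i \o w))%N then u (sgen i \o w) else u w
}.

Definition cyc_decreasing_word (n : nat) (a : seq 'Z_n) : Prop :=
  uniq a /\
  forall i : 'Z_n, i \in a -> i + 1 \in a ->
    (index (i + 1)%R a < index i a)%N.

Definition cyc_decreasing (n : nat) (v : int -> int) : Prop :=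
  exists2 a : seq 'Z_n, reduced_word v a & cyc_decreasing_word a.

(* A class of factorizations modulo trailing identity factors is represented
   by its unique member that does not end with an identity factor. *)
Definition cyc_dec_factorization (n : nat) (U : pzRingType)
    (u : (int -> int) -> U) (w : int -> int) : set (seq (int -> int)) :=
  [set alpha | [/\ forall v, v \in alpha -> cyc_decreasing n v,
                   u w = \prod_(v <- alpha) u v &
                   forall beta, alpha <> rcons beta id]].

Definition fact_size (n : nat) (alpha : seq (int -> int)) : nat :=
  \big[addn/0%N]_(v <- alpha) len n v.

(* A power series is the function sending a monomial to its coefficient.
   Monomials are in variables x_k, k : nat; only k >= 1 is ever used. *)
Definition fps : Type := {cmonom nat} -> int.

Definition xvar (k : nat) : {cmonom nat} := ucm k.

Definition fps_monom (c : int) (m : {cmonom nat}) : fps :=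
  fun m' => if m' == m then c else 0.

Definition fps_summable (I : choiceType) (A : set I) (F : I -> fps) : Prop :=
  forall m, finite_set [set i | A i /\ F i m != 0].

(* Meaningful for summable families only, since the sum below is 0 on infinite
   supports. *)
Definition fps_sum (I : choiceType) (A : set I) (F : I -> fps) : fps :=
  fun m => \sum_(i \in A) F i m.

Definition fact_monom (n : nat) (alpha : seq (int -> int)) : {cmonom nat} :=
  \big[mmul/mone]_(i < size alpha)
    \big[mmul/mone]_(j < len n (nth id alpha i)) xvar i.+1.

Definition fact_term (n : nat) (w : int -> int) (alpha : seq (int -> int)) :
    fps :=
  fps_monom ((-1) ^ ((fact_size n alpha)%:Z - (len n w)%:Z))
            (fact_monom n alpha).

Definition Gtilde (n : nat) (U : pzRingType) (u : (int -> int) -> U)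
    (w : int -> int) : fps :=
  fps_sum (cyc_dec_factorization n u w) (fact_term n w).

Definition box : Type := (int * int)%type.

Definition diagram (w : int -> int) : set box :=
  [set b | exists i j : int, [/\ i < j, w j < w i & b = (i, w j)]].

Definition fund_diagram (n : nat) (w : int -> int) : set box :=
  [set b | diagram w b /\ 1 <= b.1 <= n%:Z].

Definition labelling : Type := box -> {fset nat}.

(* Labellings live on [diagram w]; they are extended by the empty set, so that
   distinct elements of this set are distinct labellings of the diagram. *)
Definition sv_labelling (n : nat) (w : int -> int) : set labelling :=
  [set T | [/\ forall b, diagram w b -> T b != fset0,
               forall b, ~ diagram w b -> T b = fset0,
               forall b k, k \in T b -> (0 < k)%N &
               forall i j : int, diagram w (i, j) ->
                 T (i, j) = T (i + n%:Z, j + n%:Z)]].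

Definition lab_size (n : nat) (w : int -> int) (T : labelling) : nat :=
  \big[addn/0%N]_(b \in fund_diagram n w) #|` T b |%N.

Definition lab_monom (n : nat) (w : int -> int) (T : labelling) :
    {cmonom nat} :=
  \big[mmul/mone]_(b \in fund_diagram n w) \big[mmul/mone]_(k <- T b) xvar k.

Definition column_strict (w : int -> int) (T : labelling) : Prop :=
  forall a b : box, diagram w a -> diagram w b -> a <> b -> a.2 = b.2 ->
    (T a `&` T b = fset0)%fset.

(* Hooks are taken in a finite diagram [S]. *)

Definition arm (S : {fset box}) (a : box) : {fset box} :=
  [fset b in S | (b.1 == a.1) && (a.2 < b.2)]%fset.

Definition leg (S : {fset box}) (a : box) : {fset box} :=
  [fset c in S | (c.2 == a.2) && (a.1 < c.1)]%fset.

Definition hook (S : {fset box}) (a : box) : {fset box} :=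
  (a |` (arm S a `|` leg S a))%fset.

(* x <= m and x < m, for m the minimum of all labels in the boxes of B, with
   m infinite when there are none. *)
Definition le_min_labels (T : labelling) (x : nat) (B : {fset box}) : Prop :=
  forall b y, b \in B -> y \in T b -> (x <= y)%N.

Definition lt_min_labels (T : labelling) (x : nat) (B : {fset box}) : Prop :=
  forall b y, b \in B -> y \in T b -> (x < y)%N.

(* [p] picks one label in each box of the hook; its values elsewhere are
   irrelevant.  [le_min_labels T (p b) [fset b]] says p b = min T(b).
   The usual wording allows non-minimal arm labels x <= bmin; the inequality
   has to be strict.  With <=, w = 321 and n = 3 would have no labelling of
   content x_1^2 x_2^2 (the labelling {1} at the corner, {1,2} to its right,
   {2} below would be unbalanced, because of the pick 1, 2, 2), whereas
   u_321 = (u_2 u_1)(u_2 u_1) contributes - x_1^2 x_2^2 to the Grothendieck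
   series.  The two versions agree on labellings with pairwise disjoint labels. *)
Definition hook_pick (S : {fset box}) (T : labelling) (a : box)
    (p : box -> nat) : Prop :=
  [/\ forall b, b \in hook S a -> p b \in T b,
      forall b, b \in arm S a ->
        le_min_labels T (p b) [fset b]%fset \/ lt_min_labels T (p b) (leg S a) &
      forall c, c \in leg S a ->
        le_min_labels T (p c) [fset c]%fset \/ le_min_labels T (p c) (arm S a)].

(* When the labels are rearranged increasingly along the arm from right to left,
   then through the corner and down the leg, the corner comes right after the
   #|arm| smallest ones. *)
Definition balanced_single_hook (S : {fset box}) (a : box) (p : box -> nat) :
    Prop :=
  nth 0%N (sort leq [seq p b | b <- hook S a]) #|` arm S a | = p a.

Definition balanced_hook (S : {fset box}) (T : labelling) (a : box) : Prop :=
  forall p, hook_pick S T a p -> balanced_single_hook S a p.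

Definition subdiagram (w : int -> int) (i j k : int) : {fset box} :=
  [fset b in [seq (r, c) | r <- [:: i; j; k], c <- [:: w i; w j; w k]]
     | b \in diagram w]%fset.

Definition balanced (w : int -> int) (T : labelling) : Prop :=
  forall i j k : int, i < j -> j < k ->
    forall a, a \in subdiagram w i j k ->
      balanced_hook (subdiagram w i j k) T a.

Definition balanced_labelling (n : nat) (w : int -> int) : set labelling :=
  [set T | [/\ sv_labelling n w T, column_strict w T & balanced w T]].

Definition lab_term (n : nat) (w : int -> int) (T : labelling) : fps :=
  fps_monom ((-1) ^ ((lab_size n w T)%:Z - (len n w)%:Z)) (lab_monom n w T).

(* Main.v *)
Require Import Defs.
From mathcomp Require Import all_boot all_order all_algebra.
From mathcomp Require Import finmap monalg.
From mathcomp Require Import all_classical.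
From mathcomp Require Import zify.

(** Both sides of the identity count the histories of one and the same sorting
    process.

    Read a word in the generators from left to right, starting with the
    identity: the letter i exchanges the values at positions i and i + 1
    (modulo n) when they increase, and does nothing otherwise.  This is how the
    u_i multiply on the right ([u_step]), so the factorizations of u_w are the
    runs that end at w.  Let factor number t write, at each of its letters i,
    the label t into the box of the two values at positions i and i + 1,
    whether or not they are exchanged.  Boxes are indexed below by their pair
    of values p < q rather than by row and column, because the values keep
    their names while the rows move: the box lies in column p and in the row
    of q, and it belongs to the diagram when q stands to the left of p.  The
    labels so written form the labelling attached to the factorization.  Three
    observations show that this is a bijection that preserves weights.

    First, column-strictness and balancedness together amount to a condition
    [bal] on the three label sets of every triple of values ([bal_balanced],
    [balanced_bal], [column_strict_bal]).  When t is at least every label in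
    use, and the columns at positions i and i + 1 do not contain t, writing t
    for the letter i neither creates nor destroys this condition
    ([step_bal]): the two values are neighbours, so a third value stands on
    the same side of both, and in each of the resulting patterns a new largest
    label is harmless.

    Second, a cyclically decreasing word always meets this requirement, and
    after the factor t the columns that contain t are those at positions i + 1
    for the letters i of the factor ([run_word_valid]).  Thus the letters of
    the last factor are visible in the labelling, and they determine the factor
    because the order of the remaining pairs of letters is irrelevant
    ([foldl_comm]).

    Third, every balanced labelling arises.  Let t be its largest label.  Some
    column does not contain t ([ex_noncol]), so unless t is absent there is an
    i such that t occurs in the column at position i + 1 but not in the column
    at position i.  Balancedness forces this t into the box of the values at
    positions i and i + 1 ([last_adj]), where it can be erased, the two values
    being exchanged back if the box becomes empty ([unstepK]).  Repeating this
    reads a cyclically decreasing word backwards ([peel_word]).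

    Each letter writes one label per period of the diagram, whence the
    equality of monomials and signs ([run_wt], [wt_fund_diagram]).  A
    coefficient involves only finitely many factorizations, and the bijection
    carries this over to labellings. *)

Set Implicit Arguments.
Unset Strict Implicit.
Unset Printing Implicit Defensive.

Import Order.TTheory GRing.Theory Num.Theory.

Local Open Scope ring_scope.
Local Open Scope classical_set_scope.

(** * Residues and the generators *)

Section Residues.
Variables (n : nat) (n_ge2 : (2 <= n)%N).

Definition res (x : int) : 'Z_n := x%:~R.

Lemma Zn_lt (k : 'Z_n) : (k < n)%N.
Proof. by case: n n_ge2 k => [|[|m]] //= _ k; apply: ltn_ord. Qed.

Lemma resD x y : res (x + y) = res x + res y.
Proof. by rewrite /res rmorphD. Qed.

Lemma resB x y : res (x - y) = res x - res y.
Proof. by rewrite /res rmorphB. Qed.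

Lemma res1 : res 1 = 1. Proof. by []. Qed.

Lemma res_nat (i : 'Z_n) : res (i : nat)%:Z = i.
Proof. by rewrite /res -pmulrn natr_Zp. Qed.

Lemma res_eq0 x : (res x == 0) = (n%:Z %| x)%Z.
Proof.
have resN m : (m%:R == 0 :> 'Z_n) = (n %| m)%N.
  by rewrite -val_eqE /= val_Zp_nat.
rewrite /res dvdzE; case: x => m /=; first by rewrite -pmulrn resN.
by rewrite NegzE rmorphN oppr_eq0 /= -pmulrn resN.
Qed.

Lemma res_eq x y : (res x == res y) = (x == y %[mod n%:Z])%Z.
Proof. by rewrite eqz_mod_dvd -res_eq0 resB subr_eq0. Qed.

Lemma resn : res n%:Z = 0.
Proof. by apply/eqP; rewrite res_eq0 dvdzz. Qed.

Lemma resDn x : res (x + n%:Z) = res x.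
Proof. by rewrite resD resn addr0. Qed.

Lemma res_inj x y : res x = res y -> exists k, x = y + k * n%:Z.
Proof.
move/eqP; rewrite res_eq eqz_mod_dvd => /dvdzP[k e].
by exists k; rewrite -e addrC subrK.
Qed.

Lemma resDkn x k : res (x + k * n%:Z) = res x.
Proof. by rewrite resD /res rmorphM /= -/(res n) resn mulr0 addr0. Qed.

Lemma Zn_1neq0 : 1 != 0 :> 'Z_n. Proof. exact: oner_neq0. Qed.

Lemma res_succ_neq x i : res x = i -> res (x + 1) <> i.
Proof.
move=> <- /eqP; rewrite resD res1 -subr_eq0 addrC addKr.
by rewrite (negPf Zn_1neq0).
Qed.

Lemma sgenE (i : 'Z_n) x :
  sgen i x = if res x == i then x + 1
             else if res x == i + 1 then x - 1 else x.
Proof.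
by rewrite /sgen -!res_eq // resD res_nat.
Qed.

Lemma sgen_i (i : 'Z_n) x : res x = i -> sgen i x = x + 1.
Proof. by move=> e; rewrite sgenE e eqxx. Qed.

Lemma sgen_i1 (i : 'Z_n) x : res x = i -> sgen i (x + 1) = x.
Proof.
move=> e; rewrite sgenE; case: eqP => [/(res_succ_neq e)//|_].
by rewrite resD res1 e eqxx addrK.
Qed.

Lemma sgen_out (i : 'Z_n) x : res x <> i -> res x <> i + 1 -> sgen i x = x.
Proof. by move=> /eqP/negPf e1 /eqP/negPf e2; rewrite sgenE e1 e2. Qed.

Lemma sgenK (i : 'Z_n) : involutive (sgen i).
Proof.
move=> x; have [e|ne] := eqVneq (res x) i.
  by rewrite (sgen_i e) sgen_i1.
have [e|ne'] := eqVneq (res x) (i + 1).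
  have e' : res (x - 1) = i by rewrite resB res1 e addrK.
  by rewrite -{1}(subrK 1 x) (sgen_i1 e') (sgen_i e') subrK.
by rewrite !(sgen_out (elimN eqP ne) (elimN eqP ne')).
Qed.

Lemma sgen_per (i : 'Z_n) x : sgen i (x + n%:Z) = sgen i x + n%:Z.
Proof. by rewrite !sgenE resDn; do 2?case: ifP => _ //; lia. Qed.

(** The unordered pairs of positions exchanged by the generator i; this is the
    only situation in which it reverses an order ([sgen_lt], [sgen_mono]). *)
Definition adjp (i : 'Z_n) (x y : int) : bool :=
  ((res x == i) && (y == x + 1)) || ((res y == i) && (x == y + 1)).

Lemma adjpC i x y : adjp i x y = adjp i y x.
Proof. by rewrite /adjp orbC. Qed.

Lemma adjpP i x y : reflect
  ((res x = i /\ y = x + 1) \/ (res y = i /\ x = y + 1)) (adjp i x y).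
Proof.
apply: (iffP orP) => -[]; try by move=> /andP[/eqP ? /eqP ?]; auto.
  by move=> [-> ->]; left; rewrite !eqxx.
by move=> [-> ->]; right; rewrite !eqxx.
Qed.

Lemma adjp_res i x y : adjp i x y -> res x = i \/ res x = i + 1.
Proof. by case/adjpP => -[e e']; [left | right; rewrite e' resD e]. Qed.

Lemma sgen_lt i x y : x < y -> sgen i x < sgen i y \/ adjp i x y.
Proof.
move=> lxy; have [|nadj] := boolP (adjp i x y); [by right|left].
rewrite !sgenE; case: eqP => [ex|nx].
  case: eqP => [ey|ny]; first lia.
  have n1 : y <> x + 1 by move=> e; case/adjpP: nadj; left.
  case: eqP => [ey|ny1]; last lia.
  have n2 : y <> x + 2.
    move=> e; have e2 : y - 1 = x + 1 by lia.
    have := res_succ_neq ex; apply.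
    by rewrite -e2 resB ey res1 addrK.
  lia.
case: (res y =P i) => [ey|ny]; first by case: ifP => _; lia.
case: (res x =P i + 1) => [ex|nx1].
  by case: ifP => _; lia.
case: eqP => [ey|_]; last lia.
have n1 : y <> x + 1.
  move=> e; apply: nx.
  have -> : x = y - 1 by lia.
  by rewrite resB ey res1 addrK.
lia.
Qed.

Lemma sgen_mono i x y : ~~ adjp i x y -> (sgen i x < sgen i y) = (x < y).
Proof.
move=> nadj; apply/idP/idP => [lxy|/(@sgen_lt i)[]//]; last by rewrite (negPf nadj).
have [//|lyx|e] := ltgtP x y; last by move: lxy; rewrite e ltxx.
case/(@sgen_lt i): lyx => [|]; last by rewrite adjpC (negPf nadj).
by move=> /(lt_trans lxy); rewrite ltxx.
Qed.

Lemma adjp_sgen i x y : adjp i (sgen i x) (sgen i y) = adjp i x y.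
Proof.
suff H a b : adjp i a b -> adjp i (sgen i a) (sgen i b).
  by apply/idP/idP => /H //; rewrite !sgenK.
by case/adjpP => -[e ->]; rewrite (sgen_i e) (sgen_i1 e); apply/adjpP; [right|left].
Qed.

End Residues.

(** * Affine permutations *)

Section AffinePerms.
Variables (n : nat) (n_ge2 : (2 <= n)%N).
Local Notation res := (@res n).

Definition periodic (g : int -> int) := forall x, g (x + n%:Z) = g x + n%:Z.

Lemma periodicM g : periodic g -> forall x k, g (x + k * n%:Z) = g x + k * n%:Z.
Proof.
move=> gP x; suff H (m : nat) y : g (y + m%:Z * n%:Z) = g y + m%:Z * n%:Z.
  case=> m; first exact: H.
  have := H m.+1 (x + Negz m * n%:Z).
  rewrite -addrA -mulrDl NegzE addNr mul0r addr0 => ->.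
  by rewrite -addrA -mulrDl subrr mul0r addr0.
elim: m y => [|m IH] y; first by rewrite mul0r !addr0.
by rewrite -addn1 PoszD mulrDl mul1r !addrA gP IH.
Qed.

Lemma sum_periodic (g : int -> int) : (forall x, g (x + n%:Z) = g x) ->
  \sum_(1 <= j < n.+1) g j%:Z = \sum_(k : 'Z_n) g (k : nat)%:Z.
Proof.
case: n n_ge2 => [|[|m]] // _ gP.
rewrite -(big_mkord xpredT (fun j : nat => g j%:Z)).
by rewrite big_nat_recr //= -{1}[m.+2%:Z]add0r gP addrC [RHS]big_nat_recl // big_add1.
Qed.

Lemma const_periodic (g : int -> int) : (forall x, g (x + n%:Z) = g x) ->
  forall x, g (res x : nat)%:Z = g x.
Proof.
move=> gP x; have gPk y (k : int) : g (y + k * n%:Z) = g y.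
  have H : periodic (fun x => g x + x) by move=> z; rewrite gP addrA.
  by have := periodicM H y k; lia.
have [k ->] : exists k, x = (res x : nat)%:Z + k * n%:Z; last by rewrite gPk resDkn // res_nat.
by apply: res_inj; rewrite // res_nat.
Qed.

Lemma affine_bij w : affine_perm n w -> bijective w. Proof. by case. Qed.
Lemma affine_per w : affine_perm n w -> periodic w. Proof. by case. Qed.

Lemma affine_id : affine_perm n id.
Proof.
split=> //; first by exists id.
have H m : (\sum_(1 <= i < m.+1) i = m * m.+1 %/ 2)%N.
  by rewrite divn2 mulnC -[RHS](bin2 m.+1) -bin2_sum [RHS]big_ltn // add0n.
rewrite -H; elim: n => [|m IH]; first by rewrite !big_nil.
by rewrite big_nat_recr //= IH [in RHS]big_nat_recr.
Qed.

Lemma sum_shift w : periodic w ->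
  \sum_(1 <= i < n.+1) w i%:Z =
  \sum_(1 <= i < n.+1) i%:Z + \sum_(k : 'Z_n) (w (k : nat)%:Z - (k : nat)%:Z).
Proof.
move=> wP; rewrite -(@sum_periodic (fun x => w x - x)); last by move=> x; rewrite wP; lia.
by rewrite -big_split /=; apply: eq_bigr => i _; lia.
Qed.

(** The defect w x - x is periodic, so its sum may be taken over residues.
    There a generator permutes the terms, and its own defects 1 and -1 cancel. *)
Lemma affine_sgen w (i : 'Z_n) : affine_perm n w -> affine_perm n (w \o sgen i).
Proof.
move=> [wB wP wS]; have wsP : periodic (w \o sgen i).
  by move=> x /=; rewrite sgen_per // wP.
split=> //; first by apply: bij_comp => //; exists (sgen i); apply: sgenK.
rewrite -wS !sum_shift //; congr (_ + _).
pose d x := w x - x.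
have dP x : d (x + n%:Z) = d x by rewrite /d wP; lia.
pose c (k : 'Z_n) : 'Z_n := res (sgen i (k : nat)%:Z).
have sres x : res (sgen i x) = c (res x).
  rewrite /c; have [k {1}->] : exists k, x = (res x : nat)%:Z + k * n%:Z.
    by apply: res_inj; rewrite // res_nat.
  by rewrite (periodicM (sgen_per n_ge2 i)) resDkn // res_nat.
have cK : involutive c by move=> k; rewrite -sres sgenK // res_nat.
rewrite (eq_bigr (fun k : 'Z_n => d (c k : nat)%:Z + (sgen i (k : nat)%:Z - (k : nat)%:Z))); last first.
  by move=> k _; rewrite /c const_periodic // /d /=; lia.
rewrite big_split /= -[RHS]addr0; congr (_ + _).
  by rewrite [RHS](reindex_inj (inv_inj cK)).
rewrite (bigD1 i) //= (bigD1 (i + 1)) /=; last first.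
  by apply/eqP => e; apply: (@res_succ_neq n (i : nat)%:Z i); rewrite ?resD res_nat.
rewrite (sgen_i n_ge2 (res_nat i)).
have [k ek] : exists k, ((i + 1)%R : 'Z_n)%:Z = (i : nat)%:Z + 1 + k * n%:Z.
  by apply: res_inj; rewrite // resD !res_nat.
rewrite {1}ek (periodicM (sgen_per n_ge2 i)) sgen_i1 ?res_nat // ek big1; first lia.
move=> k' /andP[/eqP n1 /eqP n2]; rewrite sgen_out ?res_nat //; lia.
Qed.

Lemma increasing_shift (w : int -> int) : bijective w -> (forall x y : int, x < y -> w x < w y) ->
  forall x, w x = w 0 + x.
Proof.
move=> [f wK fK] wI.
have wS x : w (x + 1) = w x + 1.
  have l1 : w x < w (x + 1) by apply: wI; lia.
  have [l2|l2|//] := ltgtP (w (x + 1)) (w x + 1); first lia.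
  set y := f (w x + 1); have ey : w y = w x + 1 by rewrite fK.
  have [l|l|e] := ltgtP y x; first by have := wI _ _ l; lia.
    have [l3|l3|e] := ltgtP y (x + 1); first lia.
      by have := wI _ _ l3; lia.
    by move: ey; rewrite e; lia.
  by move: ey; rewrite e; lia.
have wN (m : nat) x : w (x + m%:Z) = w x + m%:Z.
  elim: m => [|m IH]; first by rewrite !addr0.
  by rewrite -addn1 PoszD !addrA wS IH.
case=> m; first by rewrite -{1}[Posz m]add0r wN.
by have := wN m.+1 (Negz m); rewrite NegzE addNr => ->; rewrite addrK.
Qed.

(** An increasing bijection of the integers is a translation, and the
    normalization of the sum of values leaves only the trivial one.  This is
    what makes an element determined by its inversions. *)
Lemma increasing_affine w : affine_perm n w ->
  (forall x y : int, x < y -> w x < w y) -> w = id.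
Proof.
move=> [wB wP wS] wI; have wE := increasing_shift wB wI.
suff w0 : w 0 = 0 by apply/funext => x; rewrite wE w0 add0r.
have := wS; case: affine_id => _ _ <-; rewrite (eq_bigr _ (fun (i : nat) _ => wE i%:Z)).
rewrite big_split /= sumr_const_nat subn1 /=.
move/eqP; rewrite -subr_eq0 addrK.
by rewrite mulrn_eq0 => /orP[/eqP n0|/eqP //]; move: n_ge2; rewrite n0.
Qed.

End AffinePerms.

(** * The local condition on three label sets *)

Section Triples.
Local Open Scope nat_scope.
Local Open Scope fset_scope.
Implicit Types A B C : {fset nat}.

(** The condition on values p < q < r with label sets A of (p, r), B of (q, r)
    and C of (p, q).  If all three are nonempty, the hook of the box (p, r) has
    arm (q, r) and leg (p, q); the clause that applies depends on whether the
    least label among the two lies in the arm or in the leg, that is, on which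
    of the two crossings happened first, a tie counting for the leg.  If B or C
    is empty the same clauses compare A with the other set. *)
Definition bal A B C : Prop :=
  (forall x, x \in B -> (forall y, y \in C -> x < y) ->
     forall z, z \in A -> x <= z /\ forall y, y \in C -> z < y) /\
  (forall y, y \in C -> (forall x, x \in B -> y <= x) ->
     forall z, z \in A -> y < z /\ forall x, x \in B -> z <= x).

Lemma fset_ex A : A != fset0 -> exists x, x \in A.
Proof. by case/fset0Pn => x; exists x. Qed.

(** In the next three lemmas t is at least every label.  Here it is written on
    the pair (p, q): those values are neighbours, so r is on the same side of
    both and A and B are empty together.  Being larger than every label of B,
    t affects neither which clause applies nor its conclusion. *)
Lemma bal_addC A B C t : (A == fset0) = (B == fset0) ->
  (forall k, k \in A -> k < t) -> (forall k, k \in B -> k < t) ->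
  bal A B (t |` C) <-> bal A B C.
Proof.
move=> AB At Bt; split=> -[P1 P2]; split.
- move=> x xB xC z zA.
  have [|xz zC] := P1 x xB _ z zA.
    by move=> y /fset1UP[-> |/xC //]; apply: Bt.
  by split=> // y yC; apply: zC; rewrite !inE yC orbT.
- by move=> y yC yB z zA; apply: (P2 y _ yB z zA); rewrite !inE yC orbT.
- move=> x xB xC z zA.
  have [|xz zC] := P1 x xB _ z zA.
    by move=> y yC; apply: xC; rewrite !inE yC orbT.
  by split=> // y /fset1UP[-> |/zC //]; apply: At.
- move=> y /fset1UP[-> |yC] yB z zA; last exact: (P2 y yC yB z zA).
  have : B != fset0 by rewrite -AB; apply/fset0Pn; exists z.
  by case/fset_ex => x xB; have := yB x xB; rewrite leqNgt Bt.
Qed.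

(** Here t is written on (q, r); A and C are empty together, and the column p
    to which they belong may contain t already.  Since t is never below all
    labels of a nonempty C, it only joins the labels that A must not exceed,
    in the second clause. *)
Lemma bal_addB A B C t : (A == fset0) = (C == fset0) ->
  (forall k, k \in A -> k <= t) -> (forall k, k \in C -> k <= t) ->
  bal A (t |` B) C <-> bal A B C.
Proof.
move=> AC At Ct; split=> -[P1 P2]; split.
- by move=> x xB xC z zA; apply: (P1 x _ xC z zA); rewrite !inE xB orbT.
- move=> y yC yB z zA.
  have [|yz zB] := P2 y yC _ z zA.
    by move=> x /fset1UP[-> |/yB //]; apply: Ct.
  by split=> // x xB; apply: zB; rewrite !inE xB orbT.
- move=> x /fset1UP[-> |xB] xC z zA; last exact: (P1 x xB xC z zA).
  have : C != fset0 by rewrite -AC; apply/fset0Pn; exists z.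
  by case/fset_ex => y yC; have := xC y yC; rewrite ltnNge Ct.
- move=> y yC yB z zA.
  have [|yz zB] := P2 y yC _ z zA.
    by move=> x xB; apply: yB; rewrite !inE xB orbT.
  by split=> // x /fset1UP[-> |/zB //]; apply: At.
Qed.

(** Here t is written on (p, r); the value q does not stand between p and r, so
    it forms an inversion with only one of them, and the condition just bounds
    A from below by the labels of that inversion. *)
Lemma bal_addA A B C t : (B == fset0) || (C == fset0) ->
  (forall k, k \in B -> k <= t) -> (forall k, k \in C -> k < t) ->
  bal (t |` A) B C <-> bal A B C.
Proof.
move=> BC Bt Ct; split=> -[P1 P2]; split.
- by move=> x xB xC z zA; apply: (P1 x xB xC z); rewrite !inE zA orbT.
- by move=> y yC yB z zA; apply: (P2 y yC yB z); rewrite !inE zA orbT.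
- move=> x xB xC z /fset1UP[-> |]; last exact: P1.
  split; first exact: Bt.
  by move=> y yC; case/orP: BC => /eqP e; [move: xB|move: yC]; rewrite e inE.
- move=> y yC yB z /fset1UP[-> |]; last exact: P2.
  split; first exact: Ct.
  by move=> x xB; case/orP: BC => /eqP e; [move: xB|move: yC]; rewrite e inE.
Qed.

(** Whichever clause applies separates z from the labels of C.  A clause does
    apply, because the least label of B and C triggers one. *)
Lemma bal_disjoint A B C z : bal A B C -> z \in A -> z \in C -> False.
Proof.
move=> [P1 P2] zA zC.
have [zB|] := boolP [forall x : B, z <= val x].
  have [|] := P2 z zC _ z zA; last by rewrite ltnn.
  by move=> x xB; apply: (forallP zB [` xB]).
rewrite negb_forall => /existsP[[x xB] /=]; rewrite -ltnNge => xz.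
(* descend through the labels of B below z until a clause applies *)
have := xz; have := xB; elim/ltn_ind: x {xB xz} => x IH xB xz.
have [xC|] := boolP [forall y : C, x < val y].
  have [|_ zlt] := P1 x xB _ z zA; first by move=> y yC; apply: (forallP xC [` yC]).
  by have := zlt z zC; rewrite ltnn.
rewrite negb_forall => /existsP[[y yC] /=]; rewrite -leqNgt => yx.
have [yB|] := boolP [forall x : B, y <= val x].
  have [|_ zle] := P2 y yC _ z zA; first by move=> x' x'B; apply: (forallP yB [` x'B]).
  by have := zle x xB; rewrite leqNgt xz.
rewrite negb_forall => /existsP[[x' x'B] /=]; rewrite -ltnNge => x'y.
by apply: (IH x') => //; [apply: leq_trans yx | apply: ltn_trans (leq_trans x'y yx) xz].
Qed.

End Triples.

(** * Labelled permutations and the sorting step *)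

(** A permutation, its inverse, and labels on pairs of values p < q.  Carrying
    the inverse along makes positions of values available without a choice. *)
Record state := State {
  perm_of : int -> int; pos_of : int -> int; labs : int -> int -> {fset nat} }.

Section States.
Variables (n : nat) (n_ge2 : (2 <= n)%N).
Local Notation res := (@res n).
Implicit Types (s : state) (t : nat) (i : 'Z_n) (L : int -> int -> {fset nat}).

(** The labels remember the inversions and thereby, as [labs_inj] shows, the
    permutation itself. *)
Record wf s : Prop := Wf {
  wf_aff : affine_perm n (perm_of s);
  wf_K : cancel (perm_of s) (pos_of s);
  wf_K' : cancel (pos_of s) (perm_of s);
  wf_per : forall p q, labs s (p + n%:Z) (q + n%:Z) = labs s p q;
  wf_inv : forall p q,
    (labs s p q != fset0) = (p < q) && (pos_of s q < pos_of s p) }.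

Definition balL L := forall p q r : int, p < q -> q < r ->
  bal (L p r) (L q r) (L p q).

Definition bounded t L := forall p q k, k \in L p q -> (0 < k <= t)%N.

Definition add_lab i t (f : int -> int) L : int -> int -> {fset nat} :=
  fun p q => if (p < q) && adjp i (f p) (f q) then (t |` L p q)%fset else L p q.

Definition ascent i (w : int -> int) : bool := w (i : nat)%:Z < w ((i : nat)%:Z + 1).

(** Right multiplication by a generator in the 0-Hecke monoid: descents are
    left alone, but the label is written in either case. *)
Definition step t s i : state :=
  let up := ascent i (perm_of s) in
  State (if up then perm_of s \o sgen i else perm_of s)
        (if up then sgen i \o pos_of s else pos_of s)
        (add_lab i t (pos_of s) (labs s)).

Lemma ascent_res w i x : periodic n w -> res x = i ->
  ascent i w = (w x < w (x + 1)).
Proof.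
move=> wP ex; have [k ->] : exists k, x = (i : nat)%:Z + k * n%:Z.
  by apply: res_inj; rewrite // res_nat.
by rewrite addrAC !(periodicM wP) ltrD2r.
Qed.

Lemma pos_per s : wf s -> periodic n (pos_of s).
Proof.
move=> ws x; apply: (can_inj (wf_K ws)).
by rewrite (wf_K' ws) (affine_per (wf_aff ws)) (wf_K' ws).
Qed.

Lemma adj_pos s p q : wf s -> p <> q -> pos_of s p <> pos_of s q.
Proof. by move=> ws npq /(can_inj (wf_K' ws)). Qed.

Lemma labs_lt s p q : wf s -> labs s p q != fset0 -> p < q.
Proof. by move=> ws; rewrite wf_inv // => /andP[]. Qed.

Lemma adj_ascent s i p q : wf s -> p < q -> adjp i (pos_of s p) (pos_of s q) ->
  ascent i (perm_of s) = (pos_of s p < pos_of s q).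
Proof.
move=> ws lpq /adjpP[] -[e e'].
  rewrite (ascent_res (affine_per (wf_aff ws)) e) -e' !(wf_K' ws) lpq e'; lia.
rewrite (ascent_res (affine_per (wf_aff ws)) e) -e' !(wf_K' ws) e'; lia.
Qed.

(** The label 0 is a dummy: positions after a step do not depend on it. *)
Lemma step_inv s i p q : wf s -> p < q ->
  (pos_of (step 0 s i) q < pos_of (step 0 s i) p) =
  adjp i (pos_of s p) (pos_of s q) || (pos_of s q < pos_of s p).
Proof.
move=> ws lpq /=; have [adj|nadj] /= := boolP (adjp _ _ _).
  rewrite (adj_ascent ws lpq adj); have [l|l] /= := ltP (pos_of s p) (pos_of s q).
    case/adjpP: adj => -[e e']; last lia.
    by rewrite e' (sgen_i n_ge2 e) (sgen_i1 n_ge2 e); lia.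
  have := adj_pos ws (p := p) (q := q); lia.
by case: ascent => //=; rewrite sgen_mono // adjpC.
Qed.

Lemma step_wf t s i : wf s -> wf (step t s i).
Proof.
move=> ws; split=> /=.
- by case: ascent; [apply: affine_sgen => //|]; apply: wf_aff.
- by case: ascent; [apply: (@can_comp _ _ _ _ _ _ _ (wf_K ws)); apply: sgenK|apply: wf_K].
- by case: ascent; [apply: can_comp; [apply: sgenK|apply: wf_K']|apply: wf_K'].
- move=> p q; rewrite /add_lab wf_per // !(pos_per ws) /adjp !(resDn n_ge2).
  have -> : (p + n%:Z < q + n%:Z) = (p < q) by lia.
  have E a b : (a + n%:Z == b + n%:Z + 1) = (a == b + 1) by lia.
  by rewrite !E.
- move=> p q; rewrite /add_lab; have [lpq|lqp] /= := ltP p q; last first.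
    by rewrite wf_inv // ltNge lqp.
  have /= -> := step_inv i ws lpq.
  case: adjp; last by rewrite wf_inv // lpq.
  by apply/fset0Pn; exists t; rewrite !inE eqxx.
Qed.

(** This is what guarantees that a letter with label t keeps columns strict. *)
Definition addable t s i := forall p q, t \in labs s p q ->
  res (pos_of s p) <> i /\ res (pos_of s p) <> i + 1.

Lemma addable_adj t s i p q r : addable t s i -> adjp i (pos_of s p) (pos_of s q) ->
  (t \notin labs s p r) /\ (t \notin labs s q r).
Proof.
move=> fr adj; split; apply/negP => /fr[].
  by case: (adjp_res adj).
by case: (adjp_res (etrans (adjpC _ _ _) adj)).
Qed.

(** A triple of values contains at most one pair of neighbours at positions i
    and i + 1, so a step changes at most one of the three label sets. *)
Lemma step_bal t s i : wf s -> bounded t (labs s) -> addable t s i ->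
  balL (add_lab i t (pos_of s) (labs s)) <-> balL (labs s).
Proof.
move=> ws bd fr.
have le_t p q k : k \in labs s p q -> (k <= t)%N by case/bd/andP.
have lt_t p q : t \notin labs s p q -> forall k, k \in labs s p q -> (k < t)%N.
  move=> tn k kL; rewrite ltn_neqAle (le_t _ _ _ kL) andbT.
  by apply: contraNneq tn => <-.
have ne0 p q : (labs s p q == fset0) = ~~ ((p < q) && (pos_of s q < pos_of s p)).
  by rewrite -wf_inv // negbK.
suff H p q r : p < q -> q < r ->
    bal (add_lab i t (pos_of s) (labs s) p r) (add_lab i t (pos_of s) (labs s) q r)
        (add_lab i t (pos_of s) (labs s) p q) <->
    bal (labs s p r) (labs s q r) (labs s p q).
  by split=> b p q r lpq lqr; apply/H => //; apply: b.
move=> lpq lqr; have lpr := lt_trans lpq lqr.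
have npq := adj_pos ws (p := p) (q := q) ltac:(lia).
have npr := adj_pos ws (p := p) (q := r) ltac:(lia).
have nqr := adj_pos ws (p := q) (q := r) ltac:(lia).
have s0 x := @res_succ_neq n x i.
rewrite /add_lab lpq lqr lpr /=.
have [apq|npq'] := boolP (adjp i (pos_of s p) (pos_of s q)).
  have [npr' nqr'] : ~~ adjp i (pos_of s p) (pos_of s r) /\ ~~ adjp i (pos_of s q) (pos_of s r).
    split; apply/adjpP.
      by case/adjpP: apq => -[e e'] [] [e2 e2']; rewrite ?e' ?e2' in e e2 npq npr nqr; (try exact: (s0 _ e e2)); (try exact: (s0 _ e2 e)); lia.
    by case/adjpP: apq => -[e e'] [] [e2 e2']; rewrite ?e' ?e2' in e e2 npq npr nqr; (try exact: (s0 _ e e2)); (try exact: (s0 _ e2 e)); lia.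
  rewrite (negPf npr') (negPf nqr').
  apply: bal_addC.
  - by rewrite !ne0 lpr lqr /=; case/adjpP: apq => -[e e']; lia.
  - by apply: lt_t; case: (addable_adj r fr apq).
  - by apply: lt_t; case: (addable_adj r fr apq).
have [aqr|nqr'] := boolP (adjp i (pos_of s q) (pos_of s r)).
  have npr' : ~~ adjp i (pos_of s p) (pos_of s r).
    apply/adjpP; by case/adjpP: aqr => -[e e'] [] [e2 e2']; rewrite ?e' ?e2' in e e2 npq npr nqr; (try exact: (s0 _ e e2)); (try exact: (s0 _ e2 e)); lia.
  rewrite (negPf npr').
  apply: bal_addB; try exact: le_t.
  by rewrite !ne0 lpr lpq /=; case/adjpP: aqr => -[e e']; lia.
have [apr|npr'] := boolP (adjp i (pos_of s p) (pos_of s r)); last by [].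
apply: bal_addA; first 1 last.
- exact: le_t.
- by apply: lt_t; case: (addable_adj q fr apr).
by rewrite !ne0 lqr lpq /=; case/adjpP: apr => -[e e']; lia.
Qed.

End States.

(** * Columns containing the largest label, and undoing a step *)

Section Columns.
Variables (n : nat) (n_ge2 : (2 <= n)%N).
Local Notation res := (@res n).
Implicit Types (s : state) (t : nat) (i j : 'Z_n) (L : int -> int -> {fset nat}).

(** Columns are named by the residue of the position of their value; this
    position changes with the permutation. *)
Definition has_col t s j : Prop := exists p q, t \in labs s p q /\ res (pos_of s p) = j.

Lemma step_adj t s i p q :
  adjp i (pos_of (step t s i) p) (pos_of (step t s i) q) = adjp i (pos_of s p) (pos_of s q).
Proof. by rewrite /=; case: ascent => //=; rewrite adjp_sgen. Qed.

Lemma step_adj_pos t s i p q : wf n s -> p < q -> adjp i (pos_of s p) (pos_of s q) ->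
  res (pos_of (step t s i) p) = i + 1.
Proof.
move=> ws lpq adj; have inv := step_inv n_ge2 i ws lpq.
move: (adj); rewrite -(step_adj t) => /adjpP[] -[e e']; last by rewrite e' resD e.
by have := inv; rewrite adj /= => l; move: e' => /= e'; lia.
Qed.

Lemma addable_pos t s i p q : addable t s i -> t \in labs s p q ->
  pos_of (step t s i) p = pos_of s p.
Proof. by move=> fr /fr[e1 e2] /=; case: ascent => //=; rewrite sgen_out. Qed.

Lemma add_lab_sub t i f L p q k : k \in L p q -> k \in add_lab i t f L p q.
Proof. by move=> kL; rewrite /add_lab; case: ifP => // _; rewrite !inE kL orbT. Qed.

(** After a step the smaller of the two values, whose column receives t, stands
    at position i + 1. *)
Lemma step_col t s i j : wf n s -> addable t s i ->
  has_col t (step t s i) j <-> has_col t s j \/ j = i + 1.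
Proof.
move=> ws fr; split.
  case=> p [q []]; rewrite {1}/step [labs _ _ _]/= /add_lab.
  case: ifP => [/andP[lpq adj] _|_ tL].
    by rewrite (step_adj_pos _ ws lpq adj); right.
  by rewrite (addable_pos fr tL) => <-; left; exists p, q.
case=> [[p [q [tL <-]]]|->].
  by exists p, q; rewrite (addable_pos fr tL); split=> //=; apply: add_lab_sub.
pose x := (i : nat)%:Z; pose a := perm_of s x; pose b := perm_of s (x + 1).
have adj : adjp i (pos_of s a) (pos_of s b).
  by apply/adjpP; left; rewrite /a /b !(wf_K ws) res_nat.
have [lab|lba|eab] := ltgtP a b.
- exists a, b; rewrite (step_adj_pos _ ws lab adj); split=> //=.
  by rewrite /add_lab lab adj !inE eqxx.
- rewrite adjpC in adj; exists b, a; rewrite (step_adj_pos _ ws lba adj); split=> //=.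
  by rewrite /add_lab lba adj !inE eqxx.
- by have := can_inj (wf_K ws) eab; lia.
Qed.

Lemma step_bounded t s i : (0 < t)%N -> bounded t (labs s) -> bounded t (labs (step t s i)).
Proof.
move=> t0 bd p q k /=; rewrite /add_lab; case: ifP => [_ /fset1UP[->|/bd //]|_ /bd //].
by rewrite t0 /=.
Qed.

Lemma labs_perk s p q k : wf n s -> labs s (p + k * n%:Z) (q + k * n%:Z) = labs s p q.
Proof.
move=> ws; suff H (m : nat) p' q' : labs s (p' + m%:Z * n%:Z) (q' + m%:Z * n%:Z) = labs s p' q'.
  case: k => m; first exact: H.
  rewrite -(H m.+1) -!addrA -!mulrDl NegzE addNr !mul0r !addr0 //.
elim: m p' q' => [|m IH] p' q'; first by rewrite !mul0r !addr0.
by rewrite -addn1 PoszD mulrDl mul1r !addrA wf_per.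
Qed.

(** Let m be the value just before p, and suppose that q stands further left.
    For m > q or m < p one of the three sets is empty and the condition forces
    a label above t, or t itself in the column of m.  For p < m < q the label
    t of (p, q) is compared with nonempty sets on both sides; being maximal it
    must also occur on (m, q), again in the column of m.  By hypothesis that
    column does not contain t. *)
Lemma last_adj t s i p q : wf n s -> bounded t (labs s) -> balL (labs s) ->
  ~ has_col t s i -> t \in labs s p q -> res (pos_of s p) = i + 1 ->
  pos_of s p = pos_of s q + 1.
Proof.
move=> ws bd bl nc tL ep.
have ne0 a b : (labs s a b != fset0) = (a < b) && (pos_of s b < pos_of s a) by rewrite (wf_inv ws).
have Lne a b k : k \in labs s a b -> labs s a b != fset0 by move=> ?; apply/fset0Pn; exists k.
have /andP[lpq qp] : (p < q) && (pos_of s q < pos_of s p) by rewrite -ne0; exact: Lne tL.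
have le_t a b k : k \in labs s a b -> (k <= t)%N by case/bd/andP.
pose m := perm_of s (pos_of s p - 1).
have pm : pos_of s m = pos_of s p - 1 by rewrite /m (wf_K ws).
have nt b : t \notin labs s m b.
  apply/negP => tm; apply: nc; exists m, b; split=> //.
  by rewrite pm resB ep addrK.
have [l|qm|//] := ltgtP (pos_of s p) (pos_of s q + 1); first lia.
exfalso; have {qm} qm : pos_of s q < pos_of s m by rewrite pm; lia.
have mp : pos_of s m < pos_of s p by rewrite pm; lia.
have [lmp|lpm|e] := ltgtP m p; last by move: mp; rewrite e ltxx.
  have lmq := lt_trans lmp lpq.
  have [z zA] : exists z, z \in labs s m q by apply: fset_ex; rewrite ne0 lmq.
  have C0 : labs s m p = fset0 by apply/eqP; rewrite -(negbK (_ == _)) ne0; lia.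
  have [P1 _] := bl _ _ _ lmp lpq.
  have [|tz _] := P1 t tL _ z zA; first by rewrite C0.
  have zt : z = t by apply/eqP; rewrite eqn_leq tz (le_t _ _ _ zA).
  by have := nt q; rewrite -zt zA.
have [lmq|lqm|e] := ltgtP m q; last by move: qm; rewrite e ltxx.
  have [x xB] : exists x, x \in labs s m q by apply: fset_ex; rewrite ne0 lmq.
  have [y yC] : exists y, y \in labs s p m by apply: fset_ex; rewrite ne0 lpm.
  have [P1 P2] := bl _ _ _ lpm lmq.
  have noB b : b \in labs s m q -> ~ (forall y, y \in labs s p m -> (b < y)%N).
    move=> bB bC; have [_ tC] := P1 b bB bC t tL.
    by have := tC y yC; rewrite ltnNge (le_t _ _ _ yC).
  have noC c : c \in labs s p m -> ~ (forall x, x \in labs s m q -> (c <= x)%N).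
    move=> cC cB; have [_ tB] := P2 c cC cB t tL.
    have xt : x = t by apply/eqP; rewrite eqn_leq tB // (le_t _ _ _ xB).
    by have := nt q; rewrite -xt xB.
  (* neither set can contain a label below all of the other, so there is an
     infinite descent between the two *)
  suff H k : forall b, b \in labs s m q -> (b < k)%N -> False by apply: (H x.+1 x).
  elim: k => // k IH b bB bk; apply: (noB b bB) => c cC.
  rewrite ltnNge; apply/negP => cb; apply: (noC c cC) => d dB.
  rewrite leqNgt; apply/negP => dc; apply: (IH d dB).
  by apply: leq_trans dc _; apply: leq_trans cb _.
have [z zA] : exists z, z \in labs s p m by apply: fset_ex; rewrite ne0 lpm.
have B0 : labs s q m = fset0 by apply/eqP; rewrite -(negbK (_ == _)) ne0; lia.
have [_ P2] := bl _ _ _ lpq lqm.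
have [|tz _] := P2 t tL _ z zA; first by rewrite B0.
by have := le_t _ _ _ zA; rewrite leqNgt tz.
Qed.

Lemma adj_last t s i p q : wf n s -> bounded t (labs s) -> balL (labs s) ->
  ~ has_col t s i -> has_col t s (i + 1) -> p < q -> adjp i (pos_of s p) (pos_of s q) ->
  [/\ t \in labs s p q, res (pos_of s q) = i & pos_of s p = pos_of s q + 1].
Proof.
move=> ws bd bl nc [p0 [q0 [tL ep0]]] lpq adj.
have e0 := last_adj ws bd bl nc tL ep0.
have lpq0 : p0 < q0 by apply: (labs_lt ws); apply/fset0Pn; exists t.
have rq0 : res (pos_of s q0) = i.
  by apply: (addIr 1); rewrite -res1 -resD -e0.
have shift x y : res (pos_of s x) = i -> pos_of s y = pos_of s x + 1 ->
    exists k, x = q0 + k * n%:Z /\ y = p0 + k * n%:Z.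
  move=> ex ey; have [k ek] := res_inj n_ge2 (etrans ex (esym rq0)).
  by exists k; split; apply: (can_inj (wf_K' ws));
    rewrite (periodicM (pos_per ws)) ?ey ?e0 ek // addrAC.
case/adjpP: adj => -[e e'].
  by have [k [ek ek']] := shift _ _ e e'; lia.
have [k [ek ek']] := shift _ _ e e'; split=> //.
by rewrite ek ek' labs_perk.
Qed.

Definition del_lab i t (f : int -> int) L : int -> int -> {fset nat} :=
  fun p q => if (p < q) && adjp i (f p) (f q) then (L p q `\ t)%fset else L p q.

(** Erase t from the boxes of neighbours at positions i and i + 1; the values
    are exchanged back when those boxes become empty, that is, when the step
    being undone was the one that created the inversion. *)
Definition unstep t s i : state :=
  let L := del_lab i t (pos_of s) (labs s) in
  let x := (i : nat)%:Z in
  let dn := L (perm_of s (x + 1)) (perm_of s x) == fset0 in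
  State (if dn then perm_of s \o sgen i else perm_of s)
        (if dn then sgen i \o pos_of s else pos_of s) L.

Lemma del_lab_sub t i f L p q k : k \in del_lab i t f L p q -> k \in L p q.
Proof. by rewrite /del_lab; case: ifP => // _; rewrite !inE => /andP[]. Qed.

Section Unstep.
Variables (t : nat) (s : state) (i : 'Z_n).
Hypotheses (ws : wf n s) (bd : bounded t (labs s)) (bl : balL (labs s)).
Hypotheses (nc : ~ has_col t s i) (yc : has_col t s (i + 1)).

Let x := (i : nat)%:Z.
Let a := perm_of s (x + 1).
Let b := perm_of s x.

Lemma unstep_ab : a < b.
Proof.
have adj : adjp i (pos_of s b) (pos_of s a).
  by apply/adjpP; left; rewrite /a /b !(wf_K ws) res_nat.
have [//|lba|e] := ltgtP a b; last by have := can_inj (wf_K ws) e; lia.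
by have [_ _] := adj_last ws bd bl nc yc lba adj; rewrite /a /b !(wf_K ws); lia.
Qed.

Lemma unstep_empty p q : p < q -> adjp i (pos_of s p) (pos_of s q) ->
  (del_lab i t (pos_of s) (labs s) p q == fset0) =
  (del_lab i t (pos_of s) (labs s) a b == fset0).
Proof.
move=> lpq adj; have [_ e e'] := adj_last ws bd bl nc yc lpq adj.
have [k ek] := res_inj n_ge2 (etrans e (esym (res_nat i))).
have wP := periodicM (affine_per (wf_aff ws)).
have -> : p = a + k * n%:Z by rewrite -[LHS](wf_K' ws) e' ek addrAC wP.
have -> : q = b + k * n%:Z by rewrite -[LHS](wf_K' ws) ek wP.
rewrite /del_lab labs_perk // !(periodicM (pos_per ws)).
have adjk u v : adjp i (u + k * n%:Z) (v + k * n%:Z) = adjp i u v.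
  rewrite /adjp !resDkn //; set kn := k * _.
  have E c d : (c + kn == d + kn + 1) = (c == d + 1) by lia.
  by rewrite !E.
by rewrite adjk ltrD2r.
Qed.

Lemma unstep_wf : wf n (unstep t s i).
Proof.
rewrite /unstep -/x -/a -/b; set e := _ == fset0.
split=> /=.
- by case: e; [apply: affine_sgen => //|]; exact: wf_aff ws.
- by case: e; [apply: (@can_comp _ _ _ _ _ _ _ (wf_K ws)); apply: sgenK|exact: wf_K ws].
- by case: e; [apply: can_comp; [apply: sgenK|exact: wf_K' ws]|exact: wf_K' ws].
- move=> p q; rewrite /del_lab (wf_per ws) !(pos_per ws) /adjp !(resDn n_ge2).
  have -> : (p + n%:Z < q + n%:Z) = (p < q) by lia.
  have E c d : (c + n%:Z == d + n%:Z + 1) = (c == d + 1) by lia.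
  by rewrite !E.
- move=> p q; have [lpq|lqp] /= := ltP p q; last first.
    by rewrite /del_lab ltNge lqp /= (wf_inv ws) ltNge lqp.
  have [adj|nadj] := boolP (adjp i (pos_of s p) (pos_of s q)).
    rewrite (unstep_empty lpq adj) -/e.
    have [_ e1 e2] := adj_last ws bd bl nc yc lpq adj.
    by case: e => /=; rewrite e2 ?(sgen_i n_ge2 e1) ?(sgen_i1 n_ge2 e1); lia.
  rewrite /del_lab (negPf nadj) andbF (wf_inv ws) lpq /=.
  by case: e => //=; rewrite sgen_mono // adjpC.
Qed.

Lemma unstep_adj p q : adjp i (pos_of (unstep t s i) p) (pos_of (unstep t s i) q) =
  adjp i (pos_of s p) (pos_of s q).
Proof. by rewrite /=; case: eqP => //=; rewrite adjp_sgen. Qed.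

Lemma unstepK : step t (unstep t s i) i = s.
Proof.
rewrite /step; set up := ascent _ _.
have upE : up = (del_lab i t (pos_of s) (labs s) a b == fset0).
  rewrite /up /unstep /ascent -/x -/a -/b /=; have ab := unstep_ab.
  case: eqP => _ /=; last by rewrite -/a -/b; lia.
  by rewrite (sgen_i n_ge2 (res_nat i)) (sgen_i1 n_ge2 (res_nat i)).
rewrite upE; have labE :
    add_lab i t (pos_of (unstep t s i)) (labs (unstep t s i)) = labs s.
  apply/funext => p; apply/funext => q; rewrite /add_lab unstep_adj /= /del_lab.
  case: ifP => [/andP[lpq adj]|-> //]; rewrite lpq adj /=.
  by have [tL _ _] := adj_last ws bd bl nc yc lpq adj; rewrite fsetD1K.
rewrite labE /unstep -/x -/a -/b /=; case: eqP => _; case: s => w f L //=.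
by congr State; apply/funext => y /=; rewrite sgenK.
Qed.

Lemma unstep_col_t p q : t \in labs (unstep t s i) p q ->
  [/\ t \in labs s p q, res (pos_of s p) <> i & res (pos_of s p) <> i + 1].
Proof.
move=> tL; have tL' := del_lab_sub tL; split=> // e.
  by apply: nc; exists p, q.
have e' := last_adj ws bd bl nc tL' e.
have lpq : p < q by apply: (labs_lt ws); apply/fset0Pn; exists t.
have adj : adjp i (pos_of s p) (pos_of s q).
  apply/adjpP; right; split=> //.
  by apply: (addIr 1); rewrite -res1 -resD -e'.
by move: tL; rewrite /= /del_lab lpq adj !inE eqxx.
Qed.

Lemma unstep_addable : addable t (unstep t s i) i.
Proof.
move=> p q /unstep_col_t[_ e1 e2]; rewrite /=; case: eqP => _ //=.
by rewrite sgen_out.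
Qed.

Lemma unstep_bounded : bounded t (labs (unstep t s i)).
Proof. by move=> p q k /del_lab_sub /bd. Qed.

(** The equivalence of [step_bal], read backwards. *)
Lemma unstep_bal : balL (labs (unstep t s i)).
Proof.
apply/(step_bal n_ge2 unstep_wf unstep_bounded unstep_addable).
by have := bl; rewrite -{1}unstepK.
Qed.

Lemma unstep_col j : has_col t (unstep t s i) j <-> has_col t s j /\ j <> i + 1.
Proof.
have := step_col (t := t) (i := i) j unstep_wf unstep_addable.
rewrite unstepK => H; split.
  move=> c; split; first by apply/H; left.
  by move=> e; case: c => p [q [/unstep_addable[_ h] e2]]; apply: h; rewrite e2.
by case=> /H[].
Qed.

End Unstep.
End Columns.

(** * Cyclically decreasing words *)

Section CyclicWords.
Variables (n : nat) (n_ge2 : (2 <= n)%N).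
Local Notation res := (@res n).
Implicit Types (s : state) (t : nat) (i j l : 'Z_n) (a b : seq 'Z_n).

(** Being cyclically decreasing is a condition on pairs of letters in the order
    in which they occur; unlike the definition by indices, this form passes to
    subwords and prefixes. *)
Definition may_precede i j : bool := (i != j) && (j != i + 1).
Definition cycw a : bool := pairwise may_precede a.

Lemma cycw_rcons a l : cycw (rcons a l) = [&& l \notin a, l - 1 \notin a & cycw a].
Proof.
rewrite /cycw pairwise_rcons andbA; congr (_ && _).
apply/allP/andP => [H|[n1 n2] x xa].
  split; apply/negP => /H; rewrite /may_precede; first by rewrite eqxx.
  by rewrite subrK eqxx andbF.
rewrite /may_precede; apply/andP; split; first by apply: contraNneq n1 => <-.
by apply: contraNneq n2 => ->; rewrite addrK.
Qed.

Lemma Zn_succ_neq l : l + 1 != l.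
Proof. by rewrite -subr_eq0 addrAC subrr add0r oner_neq0. Qed.

Lemma cyc_decreasingP a : cyc_decreasing_word a <-> cycw a.
Proof.
elim/last_ind: a => [|a l IH]; first by split=> // _; split.
have idx x : x \in a -> index x (rcons a l) = index x a.
  by move=> xa; rewrite -cats1 index_cat xa.
have idxl : l \notin a -> index l (rcons a l) = size a.
  by move=> la; rewrite -cats1 index_cat (negPf la) /= eqxx addn0.
rewrite cycw_rcons; split.
  case; rewrite rcons_uniq => /andP[la ua] H; rewrite la /=; apply/andP; split.
    apply/negP => l1; have := H (l - 1); rewrite subrK !mem_rcons !inE l1 eqxx orbT.
    by move=> /(_ isT isT); rewrite idxl // idx // ltnNge index_size.
  apply/IH; split=> // i ia i1a.
  by rewrite -(idx i) // -(idx (i + 1)) //; apply: H; rewrite mem_rcons inE ?ia ?i1a orbT.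
case/and3P => la l1a /IH[ua H]; split; first by rewrite rcons_uniq la.
move=> i; rewrite !mem_rcons !inE => /orP[/eqP->|ia].
  rewrite (negPf (Zn_succ_neq l)) /= => l2; by rewrite idxl // idx // index_mem.
case/orP=> [/eqP e|i1a]; last by rewrite !idx //; apply: H.
by move: l1a; rewrite -e addrK ia.
Qed.

(** The relative order is prescribed for letters that differ by 1, and all other
    letters commute. *)
Lemma foldl_comm (T : Type) (f : T -> 'Z_n -> T) :
  (forall (s : T) i j, i != j -> i != j + 1 -> j != i + 1 -> f (f s i) j = f (f s j) i) ->
  forall (s : T) a b, cycw a -> cycw b -> a =i b -> foldl f s a = foldl f s b.
Proof.
move=> fC s a b; elim/last_ind: b a => [|b l IH] a ca cb ab.
  by case: a ab {ca} => // x a /(_ x); rewrite !inE eqxx.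
have la : l \in a by rewrite ab mem_rcons mem_head.
move: cb; rewrite cycw_rcons => /and3P[lb l1b cb].
case/splitPr: a / la ca ab => a1 a2 ca ab.
have [ca12 [n1 n2]] : cycw (a1 ++ a2) /\ (l \notin a1 ++ a2 /\ l + 1 \notin a2).
  move: ca; rewrite /cycw !pairwise_cat allrel_consr /= => /and3P[/andP[l1 c1] c2 /andP[l2 c3]].
  rewrite c1 c2 c3; split=> //; split.
    rewrite mem_cat negb_or; apply/andP; split; apply/negP.
      by move=> /(allP l1) /andP[/eqP].
    by move=> /(allP l2) /andP[/eqP].
  by apply/negP => /(allP l2) /andP[_ /eqP].
have mem x : (x \in a1 ++ a2) = (x \in b).
  have := ab x; rewrite mem_rcons !mem_cat !inE.
  case: eqP => [-> _|_]; last by [].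
  by rewrite (negPf lb) -mem_cat (negPf n1).
rewrite foldl_rcons -(IH _ ca12 cb mem) !foldl_cat /=.
have : all (fun j => [&& l != j, l != j + 1 & j != l + 1]) a2.
  apply/allP => j ja2; apply/and3P; split.
  - by apply: contraNneq n1 => ->; rewrite mem_cat ja2 orbT.
  - by apply: contraNneq l1b => ->; rewrite addrK -mem mem_cat ja2 orbT.
  - by apply: contraNneq n2 => <-.
elim: a2 (foldl f s a1) {ca ab ca12 n1 n2 mem} => //= j a2 IHa x /andP[/and3P[e1 e2 e3] h].
by rewrite fC // IHa.
Qed.

Lemma cycw_uniq a : cycw a -> uniq a.
Proof. by move/cyc_decreasingP => []. Qed.

Definition run_word t s a : state := foldl (step t) s a.

Definition valid t s := [/\ wf n s, bounded t (labs s) & balL (labs s)].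

Lemma step_valid t s i : (0 < t)%N -> valid t s -> addable t s i -> valid t (step t s i).
Proof.
move=> t0 [ws bd bl] fr; split; [exact: step_wf|exact: step_bounded|].
exact/(step_bal n_ge2 ws bd fr).
Qed.

Lemma col_addable t s i : ~ has_col t s i -> ~ has_col t s (i + 1) -> addable t s i.
Proof. by move=> c1 c2 p q tL; split=> e; [apply: c1|apply: c2]; exists p, q. Qed.

(** When the letter l is read, neither l nor l - 1 has been read, so the columns
    at positions l + 1 and l do not contain t yet. *)
Lemma run_word_valid t s a : (0 < t)%N -> valid t s -> (forall j, ~ has_col t s j) ->
  cycw a -> valid t (run_word t s a) /\
    forall j, has_col t (run_word t s a) j <-> j - 1 \in a.
Proof.
move=> t0 vs nc; elim/last_ind: a => [|a l IH].
  by move=> _; split=> // j; split=> // /nc.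
rewrite cycw_rcons => /and3P[la l1a /IH[v c]].
have fr : addable t (run_word t s a) l.
  by apply: col_addable => /c; [rewrite (negPf l1a)|rewrite addrK (negPf la)].
rewrite /run_word foldl_rcons -/(run_word t s a); split; first exact: step_valid.
move=> j; have [ws _ _] := v; rewrite (step_col n_ge2 j ws fr) c mem_rcons inE.
by split=> [[->|->]|/orP[/eqP <-|->]]; rewrite ?addrK ?eqxx ?orbT ?subrK; auto.
Qed.

Lemma run_word_addable t s a l : (0 < t)%N -> valid t s -> (forall j, ~ has_col t s j) ->
  cycw (rcons a l) -> addable t (run_word t s a) l.
Proof.
move=> t0 vs nc; rewrite cycw_rcons => /and3P[la l1a ca].
have [_ c] := run_word_valid t0 vs nc ca.
by apply: col_addable => /c; [rewrite (negPf l1a)|rewrite addrK (negPf la)].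
Qed.

(** At a position where w x - x is maximal no larger value stands to the left,
    so the column of the value there is empty. *)
Lemma ex_noncol t s : wf n s -> exists j, ~ has_col t s j.
Proof.
move=> ws; pose w := perm_of s.
have wP : periodic n w := affine_per (wf_aff ws).
pose d (x : int) := w x - x.
have dP x : d (res x : nat)%:Z = d x.
  by apply: (@const_periodic n n_ge2 d) => y; rewrite /d wP; lia.
case: (@Order.TotalTheory.arg_maxP _ _ _ (0 : 'Z_n) xpredT (fun k : 'Z_n => d (k : nat)%:Z)) => // k _ kmax.
exists k => -[p [q [tL e]]].
have : labs s p q != fset0 by apply/fset0Pn; exists t.
rewrite (wf_inv ws) => /andP[lpq lqp].
have := kmax (res (pos_of s q)) isT; rewrite dP -e dP /d /w !(wf_K' ws); lia.
Qed.

(** Otherwise the set of residues in question would be closed under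
    subtracting 1; but it is nonempty by assumption and not full by
    [ex_noncol]. *)
Lemma ex_peel_pos t s : wf n s -> (exists j, has_col t s j) ->
  exists i, ~ has_col t s i /\ has_col t s (i + 1).
Proof.
move=> ws [j cj]; apply: contrapT => H; have [k] := ex_noncol t ws; apply.
have H1 i : has_col t s (i + 1) -> has_col t s i.
  by move=> c; apply: contrapT => nc; apply: H; exists i.
have H2 (m : nat) : has_col t s (j - m%:R).
  elim: m => [|m IH]; first by rewrite subr0.
  by apply: H1; rewrite -natr1 opprD addrA subrK.
by have := H2 (j - k : 'Z_n); rewrite natr_Zp opprB addrC subrK.
Qed.

Lemma nocol_bounded t s : bounded t.+1 (labs s) -> (forall j, ~ has_col t.+1 s j) ->
  bounded t (labs s).
Proof.
move=> bd nc p q k kL; have /andP[-> kt] := bd _ _ _ kL.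
rewrite /= -ltnS ltn_neqAle kt andbT; apply/eqP => e.
by apply: (nc (res (pos_of s p))); exists p, q; rewrite -e.
Qed.

Lemma bounded_nocol t s : bounded t (labs s) -> forall j, ~ has_col t.+1 s j.
Proof. by move=> bd j [p [q [/bd]]]; rewrite ltnn. Qed.

Lemma boundedW t s : bounded t (labs s) -> bounded t.+1 (labs s).
Proof. by move=> bd p q k /bd/andP[-> /leqW]. Qed.

(** Induction on the number of residues whose column contains the top label. *)
Lemma peel_word t s : valid t.+1 s ->
  exists s0 a, [/\ valid t s0, cycw a & run_word t.+1 s0 a = s].
Proof.
move: {2}_.+1 (ltnSn #|[pred j : 'Z_n | `[< has_col t.+1 s j >]]|) => N leN.
elim: N s leN => // N IH s leN [ws bd bl].
have [/(ex_peel_pos ws)[i [nc yc]]|nc] := pselect (exists j, has_col t.+1 s j); last first.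
  by exists s, [::]; split=> //; split=> //; apply: nocol_bounded => // j c; apply: nc; exists j.
have colE := unstep_col n_ge2 ws bd bl nc yc.
have [||s0 [a [v0 ca e]]] := IH (unstep t.+1 s i).
- rewrite ltnS in leN; apply: leq_trans leN; apply: proper_card; apply/properP; split.
    by apply/fintype.subsetP => j /asboolP c; apply/asboolP; have [] := (colE j).1 c.
  exists (i + 1); first exact/asboolP.
  by apply/asboolP => c; have [] := (colE (i + 1)).1 c.
- by split; [exact: unstep_wf|exact: unstep_bounded|exact: unstep_bal].
exists s0, (rcons a i); split=> //; last first.
  by rewrite /run_word foldl_rcons -/(run_word _ _ _) e unstepK.
have [w0 b0 l0] := v0.
have v0' : valid t.+1 s0 by split=> //; apply: boundedW.
have [_ c] := run_word_valid (ltn0Sn t) v0' (bounded_nocol b0) ca.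
rewrite e in c; rewrite cycw_rcons ca andbT; apply/andP; split; apply/negP => h.
  have /colE[_] : has_col t.+1 (unstep t.+1 s i) (i + 1) by apply/c; rewrite addrK.
  by [].
by have /colE[/nc] : has_col t.+1 (unstep t.+1 s i) i by apply/c.
Qed.

End CyclicWords.

(** * Sums over a fundamental domain *)

Section Weights.
Variables (n : nat) (n_ge2 : (2 <= n)%N).
Local Notation res := (@res n).
Variables (R : Type) (idx : R) (op : Monoid.com_law idx).
Implicit Types (s : state) (t : nat) (i : 'Z_n) (L : int -> int -> {fset nat}).

Definition dom : set (int * int) := [set x | 1 <= x.1 <= n%:Z].

(** Each orbit of boxes under translation is counted once, at its
    representative whose column lies in 1, ..., n.  Unlike representatives by
    rows, these do not depend on the permutation. *)
Definition wt (f : {fset nat} -> R) L : R :=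
  \big[op/idx]_(x \in dom) f (L x.1 x.2).

Lemma finite_box (N : nat) :
  finite_set [set x : int * int | (0 <= x.1 <= N%:Z) /\ (0 <= x.2 <= N%:Z)].
Proof.
have : finite_set [set (nat_of_ord y.1 : int, nat_of_ord y.2 : int) |
    y in [set: 'I_N.+1 * 'I_N.+1]] by apply: finite_image; exact: finite_finset.
apply: sub_finite_set => -[p q] /= [hp hq].
have lp : (absz p < N.+1)%N by lia.
have lq : (absz q < N.+1)%N by lia.
by exists (Ordinal lp, Ordinal lq) => //=; congr pair; lia.
Qed.

(** The displacement of a value is bounded, so an inversion of p involves only
    values within twice that bound. *)
Lemma finite_labs s : wf n s -> finite_set (dom `&` [set x | labs s x.1 x.2 != fset0]).
Proof.
move=> ws; pose d (x : int) := pos_of s x - x.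
have dP x : d (res x : nat)%:Z = d x.
  by apply: (@const_periodic n n_ge2 d) => y; rewrite /d (pos_per ws); lia.
pose B := \max_(k : 'Z_n) absz (d (k : nat)%:Z).
have dB x : (absz (d x) <= B)%N by rewrite -dP; apply: (leq_bigmax (res x)).
apply: sub_finite_set (finite_box (n + B + B)) => -[p q] /= [pn].
rewrite (wf_inv ws) => /andP[lpq].
move=> l2; rewrite /dom /= in pn; split.
  lia.
have := dB p; have := dB q; rewrite /d; lia.
Qed.

Lemma wt_fin f L (Q : set (int * int)) : f fset0 = idx -> Q `<=` dom ->
  (dom `&` [set x | L x.1 x.2 != fset0]) `<=` Q ->
  wt f L = \big[op/idx]_(x \in Q) f (L x.1 x.2).
Proof.
move=> f0 Qd sQ; rewrite /wt; symmetry; apply: fsbig_widen => // x [dx nQ] /=.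
have [e|ne] := eqVneq (L x.1 x.2) fset0; first by rewrite e.
by case: nQ; apply: sQ.
Qed.

Lemma adj_pair s i : wf n s -> exists p q, [/\ p < q, 1 <= p <= n%:Z,
   adjp i (pos_of s p) (pos_of s q) &
   forall p' q', p' < q' -> 1 <= p' <= n%:Z -> adjp i (pos_of s p') (pos_of s q') ->
     p' = p /\ q' = q].
Proof.
move=> ws; pose x := (i : nat)%:Z; pose a := perm_of s x; pose b := perm_of s (x + 1).
have ea : pos_of s a = x by rewrite /a (wf_K ws).
have eb : pos_of s b = x + 1 by rewrite /b (wf_K ws).
have nab : a <> b by move=> e; move: eb; rewrite -e ea; lia.
pose m := Num.min a b; pose M := Num.max a b.
have lmM : m < M by rewrite /m /M; lia.
have adjE p q : p < q -> adjp i (pos_of s p) (pos_of s q) <->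
    exists k, p = m + k * n%:Z /\ q = M + k * n%:Z.
  move=> lpq; split.
    have sh c d : res (pos_of s c) = i -> pos_of s d = pos_of s c + 1 ->
        exists k, c = a + k * n%:Z /\ d = b + k * n%:Z.
      move=> ec ed; have [k ek] := res_inj n_ge2 (etrans ec (esym (res_nat i))).
      exists k; split; apply: (can_inj (wf_K' ws));
        by rewrite (periodicM (pos_per ws)) ?ea ?eb ?ed ek // addrAC.
    case/adjpP => -[e e']; have [k [ek1 ek2]] := sh _ _ e e'; exists k;
      rewrite /m /M; lia.
  case=> k [-> ->]; have pk := periodicM (pos_per ws).
  rewrite !pk /m /M; apply/adjpP.
  have [l|l|//] := ltgtP a b; [left|right]; rewrite ea eb resDkn // res_nat; split=> //; lia.
have [k ek] : exists k, (res (m - 1) : nat)%:Z + 1 = m + k * n%:Z.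
  by apply: res_inj => //; rewrite resD res_nat resB subrK.
exists (m + k * n%:Z), (M + k * n%:Z).
have rn := Zn_lt n_ge2 (res (m - 1)).
have bp : 1 <= m + k * n%:Z <= n%:Z by rewrite -ek; lia.
split=> //; first lia.
  by apply/adjE; [lia|exists k].
move=> p' q' l bp' /(adjE _ _ l)[k' [ep eq]].
suff e : k' = k by rewrite ep eq e.
move: bp bp'; rewrite ep => b1 b2.
have [l1|l1|//] := ltgtP k' k.
  have : (k' + 1) * n%:Z <= k * n%:Z by apply: ler_wpM2r; lia.
  lia.
have : (k + 1) * n%:Z <= k' * n%:Z by apply: ler_wpM2r; lia.
lia.
Qed.

(** A step changes the label set of a single orbit ([adj_pair]). *)
Lemma wt_step f c t s i : wf n s -> f fset0 = idx ->
  (forall X : {fset nat}, t \notin X -> f (t |` X)%fset = op c (f X)) ->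
  (forall p q, p < q -> adjp i (pos_of s p) (pos_of s q) -> t \notin labs s p q) ->
  wt f (labs (step t s i)) = op c (wt f (labs s)).
Proof.
move=> ws f0 fS nt; have [p [q [lpq bp adj pq_uniq]]] := adj_pair i ws.
pose Q := (p, q) |` (dom `&` [set x | labs s x.1 x.2 != fset0]).
have Qd : Q `<=` dom by move=> x [->//|[]].
have Qfin : finite_set Q by rewrite finite_setU; split => //; apply: finite_labs.
have out x : dom x -> x <> (p, q) -> add_lab i t (pos_of s) (labs s) x.1 x.2 = labs s x.1 x.2.
  case: x => p' q' dx nx /=; rewrite /add_lab; case: ifP => // /andP[l' a'].
  by case: nx; have [-> ->] := pq_uniq _ _ l' dx a'.
rewrite (wt_fin f0 Qd); last first.
  move=> x [dx /= ne]; have [->|nx] := pselect (x = (p, q)); first by left.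
  by right; split=> //=; rewrite -out.
rewrite (wt_fin f0 Qd); last by move=> x h; right.
have Qpq : Q (p, q) by left.
rewrite [LHS](fsbigD1 (p, q) Q _ Qfin Qpq) [in RHS](fsbigD1 (p, q) Q _ Qfin Qpq).
rewrite /= {1}/add_lab lpq adj /= fS ?nt // -Monoid.mulmA.
congr (op _ (op _ _)); apply: eq_fsbigr => x; rewrite inE => -[Qx nx].
by rewrite out //; apply: Qd.
Qed.

End Weights.

(** * Length, inversions and commutation *)

Section Length.
Variables (n : nat) (n_ge2 : (2 <= n)%N).
Local Notation res := (@res n).
Implicit Types (s : state) (t : nat) (i j : 'Z_n) (a b : seq 'Z_n) (w f : int -> int).

Definition inv_fun w : int -> int := fun y => xget 0 [set x | w x = y].

Lemma inv_funK w : bijective w -> cancel w (inv_fun w).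
Proof.
by move=> [f wK fK] x; apply: (can_inj wK); rewrite /inv_fun; case: xgetP => [? _ //|/(_ x)[]].
Qed.

Lemma inv_funK' w : bijective w -> cancel (inv_fun w) w.
Proof.
by move=> [f wK fK] y; rewrite /inv_fun; case: xgetP => [? _ //|/(_ (f y))[]]; rewrite /= fK.
Qed.

Lemma inv_funE w f : cancel w f -> cancel f w -> inv_fun w = f.
Proof.
move=> wK fK; apply/funext => y; apply: (can_inj wK).
by rewrite inv_funK' ?fK //; exists f.
Qed.

(** The diagram with the label 1 in every box: its weight counts inversions, so
    that inversions are handled as a special labelling. *)
Definition inv_state w : state := State w (inv_fun w)
  (fun p q => if (p < q) && (inv_fun w q < inv_fun w p) then [fset 1%N]%fset else fset0).

Lemma inv_state_wf w : affine_perm n w -> wf n (inv_state w).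
Proof.
move=> wA; have wB := affine_bij wA; split=> //=; [exact: inv_funK|exact: inv_funK'| |].
  have pP x : inv_fun w (x + n%:Z) = inv_fun w x + n%:Z.
    by apply: (bij_inj wB); rewrite (affine_per wA) !inv_funK'.
  by move=> p q; rewrite !pP !ltrD2r.
move=> p q; case: ifP => _; last by rewrite eqxx.
by apply/fset0Pn; exists 1%N; rewrite inE.
Qed.

(** The number of inversions modulo n, which is the length ([lenE]). *)
Definition ninv w : nat := wt n addn (fun X : {fset nat} => #|` X|%N) (labs (inv_state w)).

(** With a single label available, the labels carry no information beyond the
    permutation. *)
Lemma state_inv s : wf n s -> bounded 1 (labs s) -> s = inv_state (perm_of s).
Proof.
move=> ws bd; have eP : inv_fun (perm_of s) = pos_of s by apply: inv_funE; [exact: wf_K ws|exact: wf_K' ws].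
have : labs s = labs (inv_state (perm_of s)).
  apply/funext => p; apply/funext => q; rewrite /= eP -(wf_inv ws).
  have l1 k : k \in labs s p q -> k = 1%N by move=> /bd; lia.
  case: ifP => [/fset_ex[k kL]|/negbT]; last by rewrite negbK => /eqP.
  apply/fsetP => k'; rewrite !inE; apply/idP/eqP => [/l1 //|->].
  by rewrite -(l1 _ kL).
by rewrite /inv_state eP /=; case: s {ws bd eP} => w f L /= ->.
Qed.

Lemma inv_up w i : affine_perm n w -> ascent i w -> ninv (w \o sgen i) = (ninv w).+1.
Proof.
move=> wA up; have ws := inv_state_wf wA; pose s := inv_state w.
have e : step 1 s i = inv_state (w \o sgen i).
  have bd : bounded 1 (labs s).
    by move=> p q k /=; case: ifP; rewrite inE // => _ /eqP->.
  rewrite [LHS](state_inv (step_wf n_ge2 1 i ws) (step_bounded (i := i) (ltn0Sn 0) bd)).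
  by rewrite /= up.
rewrite /ninv -e (wt_step n_ge2 (c := 1%N) ws) //.
- by move=> X tX; rewrite /= cardfsU1 tX.
- move=> p q lpq adj; have := adj_ascent n_ge2 ws lpq adj; rewrite /= up => /esym l.
  by rewrite lpq ltNge (ltW l).
Qed.

Lemma inv_id : ninv id = 0%N.
Proof.
rewrite /ninv /wt fsbig1 // => -[p q] _ /=.
by rewrite (@inv_funE id id) //; case: ltgtP => //=; rewrite cardfs0.
Qed.

Lemma sgenKf i w : w \o sgen i \o sgen i = w.
Proof. by apply/funext => x /=; rewrite sgenK. Qed.

Lemma ascent_sgen w i : affine_perm n w -> ascent i (w \o sgen i) = ~~ ascent i w.
Proof.
move=> wA; rewrite /ascent /= (sgen_i n_ge2 (res_nat i)) (sgen_i1 n_ge2 (res_nat i)).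
rewrite -leNgt le_eqVlt; case: eqP => // /(bij_inj (affine_bij wA)); lia.
Qed.

Lemma inv_down w i : affine_perm n w -> ~~ ascent i w -> ninv w = (ninv (w \o sgen i)).+1.
Proof.
move=> wA dn; rewrite -[in LHS](sgenKf i w); apply: inv_up; first exact: affine_sgen.
by rewrite ascent_sgen.
Qed.

(** An affine permutation without descents is increasing. *)
Lemma all_ascent w : affine_perm n w -> (forall i, ascent i w) -> w = id.
Proof.
move=> wA up; apply: (increasing_affine n_ge2) => // x y lxy.
have S z : w z < w (z + 1).
  by rewrite -(ascent_res n_ge2 (affine_per wA) (erefl (res z))).
have [m ->] : exists m : nat, y = x + 1 + m%:Z by exists (absz (y - x - 1)%R); lia.
elim: m => [|m IH]; first by rewrite addr0.
by apply: lt_trans IH _; rewrite -addn1 PoszD !addrA.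
Qed.

Lemma word_perm_rcons a i : word_perm (rcons a i) = word_perm a \o sgen i.
Proof. by elim: a => //= j a ->. Qed.

Lemma word_perm_cat a b : word_perm (a ++ b) = word_perm a \o word_perm b.
Proof. by elim: a => //= j a ->. Qed.

Lemma word_perm_affine a : affine_perm n (word_perm a).
Proof.
elim/last_ind: a => [|a i IH]; first exact: affine_id.
by rewrite word_perm_rcons; apply: affine_sgen.
Qed.

Lemma inv_word_le a : (ninv (word_perm a) <= size a)%N.
Proof.
elim/last_ind: a => [|a i IH]; first by rewrite inv_id.
rewrite word_perm_rcons size_rcons; have wA := word_perm_affine a.
have [up|dn] := boolP (ascent i (word_perm a)); first by rewrite inv_up.
by move: IH; rewrite (inv_down wA dn) => /ltnW/leqW.
Qed.

(** Undo descents one at a time until none is left. *)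
Lemma ex_word w : affine_perm n w -> exists a, word_perm a = w /\ size a = ninv w.
Proof.
move: {2}(ninv w) (erefl (ninv w)) => k; elim: k w => [|k IH] w ek wA.
  exists [::]; rewrite ek; split=> //; apply/esym/all_ascent => // i.
  by apply: contraT => /(inv_down wA); rewrite ek.
have [i dn] : exists i, ~~ ascent i w.
  apply: contrapT => H; have : w = id.
    by apply: all_ascent => // i; apply: contrapT => /negP d; apply: H; exists i.
  by move=> e; move: ek; rewrite e inv_id.
have [||a [ea sa]] := IH (w \o sgen i); [|exact: affine_sgen|].
  by have := inv_down wA dn; rewrite ek => -[->].
exists (rcons a i); rewrite word_perm_rcons ea sgenKf size_rcons sa; split=> //.
by rewrite [RHS](inv_down wA dn).
Qed.

Lemma reduced_wordP w a : affine_perm n w ->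
  reduced_word w a <-> word_perm a = w /\ size a = ninv w.
Proof.
move=> wA; split=> -[ea H]; split=> //.
  apply/eqP; rewrite eqn_leq -{2}ea inv_word_le andbT.
  by have [b [eb <-]] := ex_word wA; apply: H.
by move=> b eb; rewrite H -eb inv_word_le.
Qed.

Lemma lenE w : affine_perm n w -> len n w = ninv w.
Proof.
move=> wA; rewrite /len; case: xgetP => [x _ [a /(reduced_wordP _ wA)[_ <-] <-] //|H].
by have [a /(reduced_wordP _ wA) ra] := ex_word wA; have := H (size a); case; exists a.
Qed.

Definition id_state : state := State id id (fun _ _ => fset0).

Lemma id_valid t : valid n t id_state.
Proof.
split; last by move=> p q r _ _; split.
  split=> //=; first exact: affine_id.
  by move=> p q; case: ltgtP.
by move=> p q k; rewrite inE.
Qed.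

Lemma id_nocol t j : ~ has_col t id_state j. Proof. by case=> p [q []]. Qed.

(** A non-crossing letter would find its label 1 already written in the column
    at position l + 1.  So cyclically decreasing words are reduced. *)
Lemma run_id_word a : cycw a ->
  perm_of (run_word 1 id_state a) = word_perm a /\ ninv (word_perm a) = size a.
Proof.
elim/last_ind: a => [|a l IH] ca; first by rewrite inv_id.
have nc := @id_nocol 1; have v := id_valid 1.
have fr := run_word_addable n_ge2 (ltn0Sn 0) v nc ca.
move: ca; rewrite cycw_rcons => /and3P[_ _ ca].
have [[ws bd _] _] := run_word_valid n_ge2 (ltn0Sn 0) v nc ca.
have [ep ei] := IH ca.
suff up : ascent l (word_perm a).
  rewrite word_perm_rcons size_rcons inv_up // ?ei; last exact: word_perm_affine.
  by rewrite /run_word foldl_rcons /= -/(run_word _ _ _) ep up.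
rewrite -ep; apply: contraT; set s := run_word _ _ _ in fr ws bd *.
pose x := (l : nat)%:Z; rewrite /ascent -leNgt -/x le_eqVlt => /orP[/eqP/(can_inj (wf_K ws))|lt]; first lia.
have : labs s (perm_of s (x + 1)) (perm_of s x) != fset0.
  by rewrite (wf_inv ws) lt !(wf_K ws); lia.
case/fset_ex => k kL; have := bd _ _ _ kL => k1; have {k1} k1 : k = 1%N by lia.
move: kL; rewrite k1 => /fr[_]; rewrite (wf_K ws) resD res_nat.
by [].
Qed.

Lemma cyc_decreasing_word_perm v :
  cyc_decreasing n v <-> exists2 a : seq 'Z_n, cycw a & word_perm a = v.
Proof.
split; first by case=> a [ea _] /cyc_decreasingP ca; exists a.
case=> a ca <-; exists a; last by apply/cyc_decreasingP.
apply/reduced_wordP; first exact: word_perm_affine.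
by have [_ ->] := run_id_word ca.
Qed.

(** Run both words from the identity with the label 1: the result depends only
    on the permutation, and the columns containing 1 give the letters. *)
Lemma cyc_letters a b : cycw a -> cycw b -> word_perm a = word_perm b -> a =i b.
Proof.
have nc := @id_nocol 1; have v := id_valid 1.
have E (c : seq 'Z_n) : cycw c -> run_word 1 id_state c = inv_state (word_perm c).
  move=> cc; have [ec _] := run_id_word cc.
  have [[ws bd _] _] := run_word_valid n_ge2 (ltn0Sn 0) v nc cc.
  by rewrite (state_inv ws bd) ec.
move=> ca cb eab x.
have [_ Ha] := run_word_valid n_ge2 (ltn0Sn 0) v nc ca.
have [_ Hb] := run_word_valid n_ge2 (ltn0Sn 0) v nc cb.
have := Ha (x + 1); have := Hb (x + 1); rewrite !E // eab !addrK => H1 H2.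
by apply/idP/idP => [/H2/H1|/H1/H2].
Qed.

Lemma sgen_fix (k l : 'Z_n) x : k != l -> k != l + 1 -> l != k + 1 ->
  res x = k \/ res x = k + 1 -> sgen l x = x.
Proof.
move=> /eqP m1 /eqP m2 /eqP m3 [] e; rewrite sgen_out // e //.
  by move=> /esym.
by move=> /addIr.
Qed.

Lemma sgen_res (k : 'Z_n) x : res x = k \/ res x = k + 1 ->
  res (sgen k x) = k \/ res (sgen k x) = k + 1.
Proof.
case=> e; first by right; rewrite (sgen_i n_ge2 e) resD e.
by left; rewrite -(subrK 1 x) sgen_i1 // resB e addrK.
Qed.

Lemma sgen_comm i j : i != j -> i != j + 1 -> j != i + 1 ->
  sgen i \o sgen j = sgen j \o sgen i.
Proof.
move=> n1 n2 n3; have n1' : j != i by rewrite eq_sym.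
apply/funext => x /=.
have [h|h] := pselect (res x = i \/ res x = i + 1).
  by rewrite !(sgen_fix n1 n2 n3) //; apply: sgen_res.
have [h'|h'] := pselect (res x = j \/ res x = j + 1).
  by rewrite !(sgen_fix n1' n3 n2) //; apply: sgen_res.
have ei : sgen i x = x by rewrite sgen_out //; tauto.
have ej : sgen j x = x by rewrite sgen_out //; tauto.
by rewrite ej ei ej.
Qed.

Lemma step_comm t s i j : i != j -> i != j + 1 -> j != i + 1 ->
  step t (step t s i) j = step t (step t s j) i.
Proof.
move=> n1 n2 n3.
have asc (k l : 'Z_n) w : k != l -> k != l + 1 -> l != k + 1 -> ascent k (w \o sgen l) = ascent k w.
  move=> m1 m2 m3; rewrite /ascent /= !(@sgen_fix k l) //; first by right; rewrite resD res_nat.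
  by left; rewrite res_nat.
have adjc (k l : 'Z_n) x y : k != l -> k != l + 1 -> l != k + 1 ->
    adjp k (sgen l x) (sgen l y) = adjp k x y.
  move=> m1 m2 m3.
  suff H (c d : int) : adjp k c d -> adjp k (sgen l c) (sgen l d).
    by apply/idP/idP => /H //; rewrite !sgenK.
  move=> h; rewrite !(@sgen_fix k l) //.
    by apply: adjp_res; rewrite adjpC; exact: h.
  exact: adjp_res h.
have n1' : j != i by rewrite eq_sym.
rewrite /step /=; set ui := ascent i (perm_of s); set uj := ascent j (perm_of s).
have -> : ascent j (if ui then perm_of s \o sgen i else perm_of s) = uj.
  by case: ui => //; apply: asc.
have -> : ascent i (if uj then perm_of s \o sgen j else perm_of s) = ui.
  by case: uj => //; apply: asc.
congr State.
- case: ui; case: uj => //.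
  exact: (congr1 (fun h => perm_of s \o h) (sgen_comm n1 n2 n3)).
- case: ui; case: uj => //.
  exact: (congr1 (fun h => h \o pos_of s) (esym (sgen_comm n1 n2 n3))).
- apply/funext => p; apply/funext => q; rewrite /add_lab.
  have -> : adjp j ((if ui then sgen i \o pos_of s else pos_of s) p)
     ((if ui then sgen i \o pos_of s else pos_of s) q) = adjp j (pos_of s p) (pos_of s q).
    by case: ui => //=; apply: adjc.
  have -> : adjp i ((if uj then sgen j \o pos_of s else pos_of s) p)
     ((if uj then sgen j \o pos_of s else pos_of s) q) = adjp i (pos_of s p) (pos_of s q).
    by case: uj => //=; apply: adjc.
  by case: (p < q) => //=; case: adjp => //; case: adjp.
Qed.

End Length.

(** * Hooks with at most one arm box and one leg box *)

Section Hooks.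
Implicit Types (S : {fset box}) (T : labelling) (a b c : box) (x y z : nat).

Lemma arm_neq S a b : b \in arm S a -> a != b.
Proof. by rewrite !inE => /andP[_ /andP[_ l]]; apply: contraTneq l => ->; rewrite ltxx. Qed.

Lemma leg_neq S a c : c \in leg S a -> a != c.
Proof. by rewrite !inE => /andP[_ /andP[_ l]]; apply: contraTneq l => ->; rewrite ltxx. Qed.

Lemma arm_leg_neq S a b c : b \in arm S a -> c \in leg S a -> b != c.
Proof.
rewrite !inE => /andP[_ /andP[/eqP e _]] /andP[_ /andP[_ l]].
by apply: contraTneq l => <-; rewrite e ltxx.
Qed.

Lemma sort_hook S a (p : box -> nat) (r : seq box) : uniq r -> hook S a =i r ->
  sort leq [seq p b | b <- hook S a] = sort leq [seq p b | b <- r].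
Proof.
move=> ur e; apply/perm_sortP; [exact: leq_total|exact: leq_trans|exact: anti_leq|].
by apply: perm_map; apply: uniq_perm (fset_uniq _) ur e.
Qed.

Lemma sort_pair x z : (nth 0%N (sort leq [:: z; x]) 1 = z <-> (x <= z)%N) /\
  (nth 0%N (sort leq [:: z; x]) 0 = z <-> (z <= x)%N).
Proof. by rewrite /sort /=; case: (leqP z x) => h /=; split; split => ?; lia. Qed.

Lemma median3 x y z : nth 0%N (sort leq [:: z; x; y]) 1 = z <->
  (x <= z <= y)%N || (y <= z <= x)%N.
Proof.
rewrite /sort /=.
by case: (leqP z x) => /= h1; case: (leqP z y) => /= h2; case: (leqP x y) => /= h3;
  split; lia.
Qed.

Lemma balanced_hook0 S T a : arm S a = fset0 -> leg S a = fset0 -> balanced_hook S T a.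
Proof.
move=> e1 e2 p _; rewrite /balanced_single_hook e1 cardfs0.
by rewrite (@sort_hook _ _ _ [:: a]) // => b; rewrite /hook e1 e2 !inE !orbF.
Qed.

Lemma balanced_hook_arm S T a b : arm S a = [fset b]%fset -> leg S a = fset0 ->
  balanced_hook S T a <-> forall x z, x \in T b -> z \in T a -> (x <= z)%N.
Proof.
move=> e1 e2.
have nab : a != b by apply: (@arm_neq S); rewrite e1 inE.
have S2 (p : box -> nat) : balanced_single_hook S a p <-> (p b <= p a)%N.
  rewrite /balanced_single_hook e1 cardfs1 (@sort_hook _ _ _ [:: a; b]) /=; last 2 first.
  - by rewrite inE nab.
  - by move=> c; rewrite /hook e1 e2 !inE orbF.
  by case: (sort_pair (p b) (p a)).
split=> H.
  move=> x z xb za; pose p c := if c == a then z else x.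
  have : hook_pick S T a p.
    split.
    - by move=> c; rewrite /hook e1 e2 !inE /p orbF => /orP[]/eqP->; rewrite ?eqxx // eq_sym (negPf nab).
    - by move=> c _; right; rewrite e2 => b' y; rewrite inE.
    - by move=> c; rewrite e2 inE.
  by move=> /H/S2; rewrite /p eqxx eq_sym (negPf nab).
move=> p [p1 _ _]; apply/S2; apply: H; apply: p1; rewrite /hook e1 !inE eqxx ?orbT //.
Qed.

Lemma balanced_hook_leg S T a c : arm S a = fset0 -> leg S a = [fset c]%fset ->
  balanced_hook S T a <-> forall z y, z \in T a -> y \in T c -> (z <= y)%N.
Proof.
move=> e1 e2.
have nac : a != c by apply: (@leg_neq S); rewrite e2 inE.
have S2 (p : box -> nat) : balanced_single_hook S a p <-> (p a <= p c)%N.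
  rewrite /balanced_single_hook e1 cardfs0 (@sort_hook _ _ _ [:: a; c]) /=; last 2 first.
  - by rewrite inE nac.
  - by move=> b; rewrite /hook e1 e2 !inE.
  by case: (sort_pair (p c) (p a)).
split=> H.
  move=> z y za yc; pose p b := if b == a then z else y.
  have : hook_pick S T a p.
    split.
    - by move=> b; rewrite /hook e1 e2 !inE /p => /orP[]/eqP->; rewrite ?eqxx // eq_sym (negPf nac).
    - by move=> b; rewrite e1 inE.
    - by move=> b _; right; rewrite e1 => b' x; rewrite inE.
  by move=> /H/S2; rewrite /p eqxx eq_sym (negPf nac).
move=> p [p1 _ _]; apply/S2; apply: H; apply: p1; rewrite /hook e2 !inE eqxx ?orbT //.
Qed.

Lemma balanced_hook_arm_leg S T a b c :
  arm S a = [fset b]%fset -> leg S a = [fset c]%fset ->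
  balanced_hook S T a <-> forall x y z, x \in T b -> y \in T c -> z \in T a ->
    ((forall x', x' \in T b -> (x <= x')%N) \/ (forall y', y' \in T c -> (x < y')%N)) ->
    ((forall y', y' \in T c -> (y <= y')%N) \/ (forall x', x' \in T b -> (y <= x')%N)) ->
    (x <= z <= y)%N || (y <= z <= x)%N.
Proof.
move=> e1 e2.
have nab : a != b by apply: (@arm_neq S); rewrite e1 inE.
have nac : a != c by apply: (@leg_neq S); rewrite e2 inE.
have nbc : b != c by apply: (@arm_leg_neq S a); rewrite ?e1 ?e2 inE.
have S2 (p : box -> nat) : balanced_single_hook S a p <->
    (p b <= p a <= p c)%N || (p c <= p a <= p b)%N.
  rewrite /balanced_single_hook e1 cardfs1 (@sort_hook _ _ _ [:: a; b; c]); last 2 first.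
  - by rewrite /= !inE negb_or nab nac nbc.
  - by move=> d; rewrite /hook e1 e2 !inE.
  exact: median3.
have le1 d x : le_min_labels T x [fset d]%fset <-> forall x', x' \in T d -> (x <= x')%N.
  split=> [h x' x'd|h d' x']; first by apply: (h d) => //; rewrite inE.
  by rewrite inE => /eqP->; apply: h.
have lt1 d x : lt_min_labels T x [fset d]%fset <-> forall x', x' \in T d -> (x < x')%N.
  split=> [h x' x'd|h d' x']; first by apply: (h d) => //; rewrite inE.
  by rewrite inE => /eqP->; apply: h.
split=> H.
  move=> x y z xb yc za hx hy; pose p d := if d == a then z else if d == b then x else y.
  have pa : p a = z by rewrite /p eqxx.
  have pb : p b = x by rewrite /p eq_sym (negPf nab) eqxx.
  have pc : p c = y by rewrite /p eq_sym (negPf nac) eq_sym (negPf nbc).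
  have : hook_pick S T a p.
    split.
    - by move=> d; rewrite /hook e1 e2 !inE => /orP[|/orP[]]/eqP->; rewrite ?pa ?pb ?pc.
    - by move=> d; rewrite e1 inE => /eqP->; rewrite pb e2 le1 lt1.
    - by move=> d; rewrite e2 inE => /eqP->; rewrite pc e1 !le1.
  by move=> /H/S2; rewrite pa pb pc.
move=> p [p1 p2 p3]; apply/S2; apply: H.
- by apply: p1; rewrite /hook e1 !inE eqxx orbT.
- by apply: p1; rewrite /hook e2 !inE eqxx !orbT.
- by apply: p1; rewrite /hook !inE eqxx.
- by have := p2 b; rewrite e1 e2 le1 lt1 inE; apply.
- by have := p3 c; rewrite e2 e1 !le1 inE; apply.
Qed.

End Hooks.

(** * Balancedness on triples of values *)

Section BalancedTriples.
Variables (n : nat) (n_ge2 : (2 <= n)%N) (s : state) (ws : wf n s).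
Local Notation w := (perm_of s).
Local Notation pos := (pos_of s).
Local Notation L := (labs s).

Definition lab_of (s : state) : labelling := fun b => labs s b.2 (perm_of s b.1).

Lemma diagramE b : diagram w b <-> (b.2 < w b.1) && (b.1 < pos b.2).
Proof.
case: b => r c /=; split.
  by case=> i [j [lij lw [-> ->]]]; rewrite (wf_K ws) lij lw.
by case/andP=> l1 l2; exists r, (pos c); split; rewrite ?(wf_K' ws).
Qed.

Lemma lab_of_neq0 b : (lab_of s b != fset0) = ((b.2 < w b.1) && (b.1 < pos b.2)).
Proof. by rewrite /lab_of (wf_inv ws) (wf_K ws). Qed.

Lemma mem_subdiagram i j k b : (b \in subdiagram w i j k) =
  [&& b.1 \in [:: i; j; k], pos b.2 \in [:: i; j; k], b.2 < w b.1 & b.1 < pos b.2].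
Proof.
have -> : (pos b.2 \in [:: i; j; k]) = (b.2 \in [:: w i; w j; w k]).
  have E x : (pos b.2 == x) = (b.2 == w x) by rewrite -(inj_eq (can_inj (wf_K ws))) (wf_K' ws).
  by rewrite !inE !E.
have -> : (b.2 < w b.1) && (b.1 < pos b.2) = (b \in diagram w).
  by symmetry; apply/asboolP/idP; rewrite diagramE.
rewrite /subdiagram in_fset /= inE /= !andbA; congr (_ && _).
case: b => r c; rewrite unfold_in /= !inE !xpair_eqE.
by case: (r == i) (r == j) (r == k) (c == w i) (c == w j) (c == w k)
  => [] [] [] [] [] [].
Qed.

Section Corner.
Variables (i j k r m r' : int).
Hypothesis ijk : [:: i; j; k] =i [:: r; m; r'].
Hypotheses (lr : r < r') (lw : w r' < w r).
Let S := subdiagram w i j k.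
Let a := (r, w r').

Let memS b : (b \in S) =
  [&& b.1 \in [:: r; m; r'], pos b.2 \in [:: r; m; r'], b.2 < w b.1 & b.1 < pos b.2].
Proof. by rewrite mem_subdiagram !ijk. Qed.

(** The third row and column can contribute only one box to the arm of a corner
    and only one to its leg. *)
Lemma corner_arm : arm S a =
  if (r < m) && (w r' < w m < w r) then [fset (r, w m)]%fset else fset0.
Proof.
apply/fsetP => -[b1 b2]; rewrite 2!inE; rewrite /= -/S memS /=.
apply/idP/idP.
  case/andP=> /and4P[h1 h2 h3 h4] /andP[/eqP e l]; rewrite e {b1 e h1} in h3 h4 *.
  have eb : b2 = w (pos b2) by rewrite (wf_K' ws).
  move: h2 eb; rewrite !inE => /or3P[]/eqP-> eb; rewrite eb ?(wf_K ws) in h3 h4 l *.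
  - by move: h4; rewrite ltxx.
  - by rewrite h4 l h3 inE eqxx.
  - by move: l; rewrite ltxx.
case: ifP => // /and3P[l1 l2 l3]; rewrite inE => /eqP[-> ->].
by rewrite (wf_K ws) l1 l2 l3 !inE !eqxx orbT.
Qed.

Lemma corner_leg : leg S a =
  if (r < m < r') && (w r' < w m) then [fset (m, w r')]%fset else fset0.
Proof.
apply/fsetP => -[b1 b2]; rewrite 2!inE; rewrite /= -/S memS /=.
apply/idP/idP.
  case/andP=> /and4P[h1 h2 h3 h4] /andP[/eqP e l]; rewrite e {b2 e h2} in h3 h4 *.
  rewrite (wf_K ws) in h4.
  move: h1; rewrite !inE => /or3P[]/eqP e; rewrite e in h3 h4 l *.
  - by move: l; rewrite ltxx.
  - by rewrite h4 l h3 inE eqxx.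
  - by move: h4; rewrite ltxx.
case: ifP => // /andP[/andP[l1 l2] l3]; rewrite inE => /eqP[-> ->].
by rewrite (wf_K ws) l1 l2 l3 !inE !eqxx !orbT.
Qed.

Lemma corner_in : a \in S.
Proof. by rewrite memS /= (wf_K ws) lr lw !inE !eqxx !orbT. Qed.

End Corner.

Lemma column_strict_bal : balL L -> column_strict w (lab_of s).
Proof.
move=> bl [r c] [r' c'] da db nab /= e; rewrite -e {c' e} in db nab *.
apply/fsetP => x; rewrite !inE; apply/negbTE/negP => /andP[xa xb].
have {da} : c < w r by move/diagramE: da => /andP[].
have {db} : c < w r' by move/diagramE: db => /andP[].
rewrite /lab_of /= in xa xb.
have nw : w r <> w r' by move/(can_inj (wf_K ws)) => e; apply: nab; rewrite e.
have [l|l|//] := ltgtP (w r) (w r') => h1 h2.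
  exact: bal_disjoint (bl _ _ _ h2 l) xb xa.
exact: bal_disjoint (bl _ _ _ h1 l) xa xb.
Qed.

Lemma labs_ne0 p q : p < q -> pos q < pos p -> exists x, x \in L p q.
Proof. by move=> l1 l2; apply: fset_ex; rewrite (wf_inv ws) l1 l2. Qed.

Lemma labs_eq0 p q x : pos p < pos q -> x \in L p q -> False.
Proof.
move=> l xL; have : L p q != fset0 by apply/fset0Pn; exists x.
by rewrite (wf_inv ws) => /andP[_ l']; lia.
Qed.

Lemma ex_min (X : {fset nat}) x : x \in X -> exists2 y, y \in X & forall z, z \in X -> (y <= z)%N.
Proof.
move=> xX; have ex : exists y, y \in X by exists x.
by case: (ex_minnP ex) => y yX H; exists y.
Qed.

(** The corner is the box of positions r < r', and m is the third position.
    According to the place of m and of its value, the corner has an arm and a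
    leg, an arm only, a leg only, or neither. *)
Lemma balanced_corner r m r' i j k : [:: i; j; k] =i [:: r; m; r'] ->
  r <> m -> m <> r' -> r < r' -> w r' < w r -> balL L ->
  balanced_hook (subdiagram w i j k) (lab_of s) (r, w r').
Proof.
move=> ijk n1 n2 lr lw bl.
have ea := corner_arm ijk; have el := corner_leg ijk.
have nw1 : w m <> w r by move/(can_inj (wf_K ws)) => /esym.
have nw2 : w m <> w r' by move/(can_inj (wf_K ws)).
have [arm_c|narm] := boolP ((r < m) && (w r' < w m < w r)).
  rewrite arm_c in ea; case/and3P: arm_c => l1 l2 l3.
  have [P1 P2] := bl _ _ _ l2 l3.
  have [leg_c|nleg] := boolP ((r < m < r') && (w r' < w m)); last first.
    rewrite (negPf nleg) in el.
    apply/(balanced_hook_arm _ ea el) => x z xb za.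
    have [|//] := P1 x xb _ z za => y yC.
    by case: (labs_eq0 _ yC); rewrite !(wf_K ws); lia.
  rewrite leg_c in el; case/andP: leg_c => /andP[_ l4] _.
  apply/(balanced_hook_arm_leg _ ea el) => x y z; rewrite /lab_of /= => xB yC zA hx hy.
  case: hx => hx; last by have [l zC] := P1 x xB hx z zA; rewrite l ltnW // zC.
  case: hy => hy; last by have [l zB] := P2 y yC hy z zA; have := zB _ xB; lia.
  have [lxy|lyx] := ltnP x y.
    have [|l zC] := P1 x xB _ z zA; first by move=> y' /hy; apply: leq_trans.
    by rewrite l ltnW // zC.
  have [|l zB] := P2 y yC _ z zA; first by move=> x' /hx; apply: leq_trans.
  by have := zB _ xB; lia.
rewrite (negPf narm) in ea.
have [leg_c|nleg] := boolP ((r < m < r') && (w r' < w m)); last first.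
  by rewrite (negPf nleg) in el; apply: balanced_hook0.
rewrite leg_c in el; case/andP: leg_c => /andP[l1 l2] l3.
apply/(balanced_hook_leg _ ea el) => z y; rewrite /lab_of /= => zC yA.
have l4 : w r < w m by lia.
have [_ P2] := bl _ _ _ lw l4.
have [|l _] := P2 z zC _ y yA; last exact: ltnW.
by move=> x xB; case: (labs_eq0 _ xB); rewrite !(wf_K ws); lia.
Qed.

Lemma balanced_bal : balL L -> balanced w (lab_of s).
Proof.
move=> bl i j k lij ljk [r c]; rewrite mem_subdiagram /= => /and4P[h1 h2 h3 h4].
have ec : c = w (pos c) by rewrite (wf_K' ws).
rewrite ec in h3 *; move: (pos c) h2 h3 h4 => r' h2 h3 h4 {c ec}.
suff [m [E n1 n2]] : exists m, [/\ [:: i; j; k] =i [:: r; m; r'], r <> m & m <> r'].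
  exact: balanced_corner.
have lik := lt_trans lij ljk.
move: h1 h2 h4; rewrite !inE => /or3P[]/eqP-> /or3P[]/eqP-> l; try lia.
- by exists k; split; [move=> x; rewrite !inE; case: (x == i) (x == j) (x == k) => [] [] []|lia|lia].
- by exists j; split; [move=> x; rewrite !inE; case: (x == i) (x == j) (x == k) => [] [] []|lia|lia].
- by exists i; split; [move=> x; rewrite !inE; case: (x == i) (x == j) (x == k) => [] [] []|lia|lia].
Qed.

(** For values p < v < q the corner to look at depends on the pattern: it is the
    box (p, q) when q comes first, and (p, v) when v does. *)
Lemma bal_balanced : column_strict w (lab_of s) -> balanced w (lab_of s) -> balL L.
Proof.
move=> cs balanced p v q lpv lvq.
have lpq := lt_trans lpv lvq.
have ep : w (pos p) = p by rewrite (wf_K' ws).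
have ev : w (pos v) = v by rewrite (wf_K' ws).
have eq : w (pos q) = q by rewrite (wf_K' ws).
have [A0|Ane] := eqVneq (L p q) fset0.
  by rewrite A0; split=> x _ _ z; rewrite inE.
have lQP : pos q < pos p by move: Ane; rewrite (wf_inv ws) => /andP[].
have nV1 : pos v <> pos p by move/(can_inj (wf_K' ws)); lia.
have nV2 : pos v <> pos q by move/(can_inj (wf_K' ws)); lia.
have disj x : x \in L p q -> x \in L p v -> False.
  move=> x1 x2.
  have d1 : diagram w (pos q, p) by apply/diagramE; rewrite /= eq lpq.
  have d2 : diagram w (pos v, p).
    apply/diagramE; rewrite /= ev lpv /= ltNge; apply/negP; rewrite le_eqVlt => /orP[/eqP e|l]; first by case: nV1.
    exact: (labs_eq0 l x2).
  have e0 : (lab_of s (pos q, p) `&` lab_of s (pos v, p))%fset = fset0.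
    by apply: cs => // -[e]; case: nV2.
  have : x \in (lab_of s (pos q, p) `&` lab_of s (pos v, p))%fset.
    by rewrite in_fsetI /lab_of /= eq ev x1 x2.
  by rewrite e0 inE.
have [lVQ|lQV|e] := ltgtP (pos v) (pos q); last by case: nV2.
  have lVP := lt_trans lVQ lQP.
  have E : [:: pos v; pos q; pos p] =i [:: pos v; pos q; pos p] by [].
  have lw : w (pos p) < w (pos v) by rewrite ep ev.
  have ea := corner_arm E; have el := corner_leg E.
  have Sa := corner_in E lVP lw.
  rewrite ep ev eq (lt_gtF lvq) !andbF in ea; rewrite ep eq lVQ lQP lpq /= in el.
  have := balanced _ _ _ lVQ lQP _ Sa; rewrite ep => /(balanced_hook_leg _ ea el).
  rewrite /lab_of /= ev eq => H; split=> [x xB|y yC _ z zA].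
    by case: (labs_eq0 _ xB).
  split; last by move=> x xB; case: (labs_eq0 _ xB).
  rewrite ltn_neqAle H // andbT; apply/eqP => e; apply: (disj z) => //.
  by rewrite -e.
have [lVP|lPV|e] := ltgtP (pos v) (pos p); last by case: nV1.
  have E : [:: pos q; pos v; pos p] =i [:: pos q; pos v; pos p] by [].
  have lw : w (pos p) < w (pos q) by rewrite ep eq.
  have ea := corner_arm E; have el := corner_leg E.
  have Sa := corner_in E lQP lw.
  rewrite ep ev eq lQV lpv lvq /= in ea; rewrite ep ev lQV lVP lpv /= in el.
  have := balanced _ _ _ lQV lVP _ Sa; rewrite ep => /(balanced_hook_arm_leg _ ea el).
  rewrite /lab_of /= ev eq => H.
  have [x1 /ex_min[x0 x0B x0min]] := labs_ne0 lvq lQV.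
  have [y1 /ex_min[y0 y0C y0min]] := labs_ne0 lpv lVP.
  have ne z y : z \in L p q -> y \in L p v -> z <> y.
    by move=> zA yC e; apply: (disj z); rewrite // e.
  split=> [x xB xC z zA|y yC yB z zA].
    have := H x y0 z xB y0C zA (or_intror xC) (or_introl y0min).
    have := xC _ y0C; have := ne _ _ zA y0C => h1 h2 h3; split; first lia.
    by move=> y yC; have := y0min _ yC; lia.
  have := H x0 y z x0B yC zA (or_introl x0min) (or_intror yB).
  have := yB _ x0B; have := ne _ _ zA yC => h1 h2 h3; split; first lia.
  by move=> x xB; have := x0min _ xB; lia.
have E : [:: pos q; pos p; pos v] =i [:: pos q; pos v; pos p].
  by move=> x; rewrite !inE; case: (x == pos q) (x == pos p) (x == pos v) => [] [] [].
have lw : w (pos p) < w (pos q) by rewrite ep eq.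
have ea := corner_arm E; have el := corner_leg E.
have Sa := corner_in E lQP lw.
rewrite ep ev eq lQV lpv lvq /= in ea; rewrite ep (lt_gtF lPV) andbF /= in el.
have := balanced _ _ _ lQP lPV _ Sa; rewrite ep => /(balanced_hook_arm _ ea el).
rewrite /lab_of /= eq => H; split=> [x xB _ z zA|y yC].
  by split; [exact: H|move=> y yC; case: (labs_eq0 _ yC)].
by case: (labs_eq0 _ yC).
Qed.

End BalancedTriples.

(** * Boxes in rows 1 to n against columns 1 to n *)

Section FundamentalDomain.
Variables (n : nat) (n_ge2 : (2 <= n)%N).
Local Notation res := (@res n).
Variables (R : Type) (idx : R) (op : Monoid.com_law idx).

(** The representative modulo n in 1, ..., n. *)
Definition norm (c : int) : int := (res (c - 1) : nat)%:Z + 1.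

Lemma norm_dom c : 1 <= norm c <= n%:Z.
Proof. by rewrite /norm; have := Zn_lt n_ge2 (res (c - 1)); lia. Qed.

Lemma normE c : exists k, norm c = c + k * n%:Z.
Proof. by apply: res_inj => //; rewrite /norm resD res_nat resB subrK. Qed.

Lemma normD c k : norm (c + k * n%:Z) = norm c.
Proof. by rewrite /norm addrAC resDkn. Qed.

Lemma norm_id c : 1 <= c <= n%:Z -> norm c = c.
Proof.
move=> hc; have := norm_dom c; have [k ->] := normE c; move: hc.
set m := n%:Z; move=> h1 h2.
have [l|l|->] := ltgtP k 0; last by rewrite mul0r addr0.
  have : k * m <= -1 * m by apply: ler_wpM2r; lia.
  lia.
have : 1 * m <= k * m by apply: ler_wpM2r; lia.
lia.
Qed.

(** Translating a box so that its column instead of its row lies in 1, ..., n is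
    a bijection between the two sets of representatives. *)
Lemma wt_fund_diagram (f : {fset nat} -> R) s : wf n s -> f fset0 = idx ->
  wt n op f (labs s) = \big[op/idx]_(b \in fund_diagram n (perm_of s)) f (lab_of s b).
Proof.
move=> ws f0; have wP := periodicM (affine_per (wf_aff ws)).
have pP := periodicM (pos_per ws).
pose Q := dom n `&` [set x | labs s x.1 x.2 != fset0].
rewrite (@wt_fin n R idx op f (labs s) Q f0) //.
pose h (b : box) : int * int := (norm b.2, perm_of s b.1 + (norm b.2 - b.2)).
have hE b : exists k, h b = (b.2 + k * n%:Z, perm_of s b.1 + k * n%:Z).
  by have [k e] := normE b.2; exists k; rewrite /h e; congr pair; lia.
rewrite (@reindex_fsbig _ _ _ _ _ h (fund_diagram n (perm_of s))).
  apply: eq_fsbigr => b _; have [k ->] := hE b; rewrite /= labs_perk //.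
split.
- move=> b [db _]; split; first exact: norm_dom.
  have [k ->] := hE b; rewrite /= labs_perk //.
  by move/(diagramE ws): db; rewrite -(lab_of_neq0 ws b).
- move=> [r c] [r' c']; rewrite !inE => -[_ /= hr] [_ /= hr'] e.
  have /= e1 := congr1 fst e; have /= e2 := congr1 snd e.
  have [k ek] : exists k, c' = c + k * n%:Z.
    have [k1 h1] := normE c; have [k2 h2] := normE c'.
    by exists (k1 - k2); rewrite mulrBl; lia.
  have er : r' = r + k * n%:Z.
    by apply: (can_inj (wf_K ws)); rewrite wP; lia.
  have er' : r = r' by rewrite -(norm_id hr) -(norm_id hr') er normD.
  by rewrite er' in er *; congr pair; lia.
- have shiftK (x y z : int) : x + z + (y - (y + z)) = x by lia.
  move=> [p q] [/= dp ne]; have [k ek] := normE (pos_of s q).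
  exists (norm (pos_of s q), p + k * n%:Z).
    split; last exact: norm_dom.
    apply/(diagramE ws) => /=; rewrite ek wP pP (wf_K' ws) !ltrD2r.
    by rewrite -(wf_inv ws).
  by rewrite /h /= normD (norm_id dp) ek wP (wf_K' ws); congr pair; exact: shiftK.
by move=> x [].
Qed.

End FundamentalDomain.

(** * Balanced labellings as labelled permutations *)

Section Labellings.
Variables (n : nat) (n_ge2 : (2 <= n)%N).
Local Notation res := (@res n).
Implicit Types (s : state) (t : nat) (w : int -> int).

Lemma valid_labelling t s : valid n t s -> balanced_labelling n (perm_of s) (lab_of s).
Proof.
move=> [ws bd bl]; split; [|exact: (column_strict_bal ws bl)|exact: (balanced_bal n_ge2 ws bl)].
split.
- by move=> b /(diagramE ws); rewrite (lab_of_neq0 ws).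
- move=> b nd; apply/eqP; apply: contraT; rewrite (lab_of_neq0 ws) => d.
  by case: nd; apply/(diagramE ws).
- by move=> b k /bd/andP[].
- by move=> i j _; rewrite /lab_of /= (affine_per (wf_aff ws)) (wf_per ws).
Qed.

(** Finitely many boxes modulo translation carry finitely many labels. *)
Lemma wf_bounded s : wf n s -> (forall p q k, k \in labs s p q -> (0 < k)%N) ->
  exists t, bounded t (labs s).
Proof.
move=> ws pos; have /finite_seqP[r rE] := finite_labs n_ge2 ws.
exists (\max_(x <- r) \max_(k <- labs s x.1 x.2) k)%N => p q k kL.
rewrite (pos _ _ _ kL) /=; have [c ec] := normE n_ge2 p.
rewrite -(labs_perk p q c ws) -ec in kL.
have : (norm n p, q + c * n%:Z) \in r.
  have : [set` r] (norm n p, q + c * n%:Z).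
    by rewrite -rE; split; [exact: norm_dom|apply/fset0Pn; exists k].
  by [].
move=> xr; apply: leq_trans (leq_bigmax_seq _ xr _) => //=.
exact: (@leq_bigmax_seq _ (enum_fset _) xpredT id k kL isT).
Qed.

Lemma labelling_valid w T : affine_perm n w -> balanced_labelling n w T ->
  exists s t, [/\ valid n t s, perm_of s = w & lab_of s = T].
Proof.
move=> wA [[T1 T2 T3 T4] cs bT]; have wB := affine_bij wA.
pose s := State w (inv_fun w) (fun p q => T (inv_fun w q, p)).
have TE : lab_of s = T.
  by apply/funext => -[r c]; rewrite /lab_of /= inv_funK.
have wP := affine_per wA.
have pP x : inv_fun w (x + n%:Z) = inv_fun w x + n%:Z.
  by apply: (bij_inj wB); rewrite wP !inv_funK'.
have dE p q : diagram w (inv_fun w q, p) <-> (p < q) && (inv_fun w q < inv_fun w p).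
  split; last by case/andP=> l1 l2; exists (inv_fun w q), (inv_fun w p); rewrite !inv_funK'.
  case=> i [j [lij lw [ei ->]]]; rewrite inv_funK // ei lij andbT.
  by rewrite -(inv_funK' wB q) ei.
have ne0 p q : (T (inv_fun w q, p) != fset0) = (p < q) && (inv_fun w q < inv_fun w p).
  apply/idP/idP => [h|/dE/T1 //]; apply/dE.
  by apply: contrapT => /T2 e; rewrite e eqxx in h.
have ws : wf n s.
  split=> //=; [exact: inv_funK|exact: inv_funK'|].
  move=> p q; rewrite pP; have [d|nd] := pselect (diagram w (inv_fun w q, p)).
    by rewrite -T4.
  rewrite [RHS]T2 // T2 // -pP => /dE; rewrite !pP !ltrD2r => /dE.
  exact: nd.
have [p q k kL|t bd] := wf_bounded ws; first exact: T3 kL.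
exists s, t; split=> //; split=> //.
by apply: (bal_balanced n_ge2 ws); rewrite TE.
Qed.

End Labellings.

(** * From factorizations to labelled permutations *)

Section Runs.
Variables (n : nat) (n_ge2 : (2 <= n)%N).
Local Notation res := (@res n).
Implicit Types (s : state) (t : nat) (v w : int -> int) (alpha beta : seq (int -> int)).
Implicit Types (a b : seq 'Z_n).

Lemma word_perm_foldl a : word_perm a = foldl (fun w i => w \o sgen i) id a.
Proof. by elim/last_ind: a => // a i IH; rewrite word_perm_rcons foldl_rcons IH. Qed.

Lemma word_perm_rev a : word_perm (rev a) \o word_perm a = id.
Proof.
elim: a => [|i a IH] //; rewrite rev_cons word_perm_rcons /=.
apply/funext => x; rewrite /= (sgenK n_ge2).
exact: (congr1 (fun h => h x) IH).
Qed.

(** Two affine permutations with the same inversions differ by an increasing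
    one, which is the identity.  The inverse of an affine permutation is affine
    because it is given by the reversed word. *)
Lemma labs_inj s s' : wf n s -> wf n s' -> labs s = labs s' -> s = s'.
Proof.
move=> ws ws' eL.
have [a [ea _]] := ex_word n_ge2 (wf_aff ws); have [a' [ea' _]] := ex_word n_ge2 (wf_aff ws').
have ep : pos_of s' = word_perm (rev a').
  apply/funext => y; rewrite -[y in RHS](wf_K' ws') -ea'.
  exact: (congr1 (fun h => h (pos_of s' y)) (esym (word_perm_rev a'))).
have gA : affine_perm n (pos_of s' \o perm_of s).
  by rewrite ep -ea -word_perm_cat; apply: word_perm_affine.
have gid : pos_of s' \o perm_of s = id.
  apply: (increasing_affine n_ge2 gA) => x y lxy /=.
  have ne : pos_of s' (perm_of s x) <> pos_of s' (perm_of s y).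
    by move/(can_inj (wf_K' ws'))/(can_inj (wf_K ws)); lia.
  have ninv p q : (p < q) && (pos_of s q < pos_of s p) = (p < q) && (pos_of s' q < pos_of s' p).
    by rewrite -(wf_inv ws) -(wf_inv ws') eL.
  have nxy : perm_of s x <> perm_of s y by move/(can_inj (wf_K ws)); lia.
  have := ninv (perm_of s x) (perm_of s y); have := ninv (perm_of s y) (perm_of s x).
  by rewrite !(wf_K ws); lia.
have ew : perm_of s = perm_of s'.
  apply/funext => x; apply: (can_inj (wf_K' ws')); rewrite (wf_K ws').
  exact: (congr1 (fun h => h x) gid).
have ef : pos_of s = pos_of s'.
  by apply/funext => y; apply: (can_inj (wf_K ws)); rewrite (wf_K' ws) ew (wf_K' ws').
by case: s s' eL ew ef {ws ws' gid gA ep ea ea'} => ? ? ? [? ? ?] /= -> -> ->.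
Qed.

(** A choice of word; by [cyc_letters] and [foldl_comm] the outcome of a run
    does not depend on it. *)
Definition cyc_word v : seq 'Z_n := xget [::] [set a | cycw a /\ word_perm a = v].

Lemma cyc_wordP v : cyc_decreasing n v -> cycw (cyc_word v) /\ word_perm (cyc_word v) = v.
Proof.
case/(cyc_decreasing_word_perm n_ge2) => a ca ea; rewrite /cyc_word.
by case: xgetP => [? _ [] //|/(_ a)[]].
Qed.

Lemma size_cyc_word v : cyc_decreasing n v -> size (cyc_word v) = len n v.
Proof.
case/cyc_wordP => ca e; have [_ <-] := run_id_word n_ge2 ca.
by rewrite -lenE ?e // -e; apply: word_perm_affine.
Qed.

Definition all_cyc alpha := forall v, v \in alpha -> cyc_decreasing n v.

Lemma all_cyc_rcons alpha v : all_cyc (rcons alpha v) <-> all_cyc alpha /\ cyc_decreasing n v.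
Proof.
split=> [h|[h1 h2] v'].
  by split=> [v' v'a|]; apply: h; rewrite mem_rcons inE ?v'a ?eqxx ?orbT.
by rewrite mem_rcons inE => /orP[/eqP->|/h1].
Qed.

(** The counter is the label of the factor being read. *)
Definition run alpha : nat * state :=
  foldl (fun x v => (x.1.+1, run_word x.1.+1 x.2 (cyc_word v))) (0%N, id_state) alpha.

Lemma run_size alpha : (run alpha).1 = size alpha.
Proof.
elim/last_ind: alpha => // alpha v; rewrite /run foldl_rcons /= => ->.
by rewrite size_rcons.
Qed.

Lemma run_rcons alpha v :
  (run (rcons alpha v)).2 = run_word (size alpha).+1 (run alpha).2 (cyc_word v).
Proof. by rewrite {1}/run foldl_rcons -/(run alpha) /= run_size. Qed.

Lemma run_valid alpha : all_cyc alpha -> valid n (size alpha) (run alpha).2.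
Proof.
elim/last_ind: alpha => [_|alpha v IH]; first exact: id_valid.
case/all_cyc_rcons => /IH [ws bd bl] /cyc_wordP[cv _].
rewrite size_rcons run_rcons.
have v' : valid n (size alpha).+1 (run alpha).2 by split=> //; apply: boundedW.
by have [] := run_word_valid n_ge2 (ltn0Sn _) v' (bounded_nocol bd) cv.
Qed.

Lemma run_col alpha v : all_cyc (rcons alpha v) -> forall j,
  has_col (size alpha).+1 (run (rcons alpha v)).2 j <-> j - 1 \in cyc_word v.
Proof.
case/all_cyc_rcons => /run_valid[ws bd bl] /cyc_wordP[cv _] j.
have v' : valid n (size alpha).+1 (run alpha).2 by split=> //; apply: boundedW.
rewrite run_rcons.
by have [_] := run_word_valid n_ge2 (ltn0Sn _) v' (bounded_nocol bd) cv.
Qed.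

Lemma run_word_old t s a p q k : k <> t ->
  (k \in labs (run_word t s a) p q) = (k \in labs s p q).
Proof.
move=> nk; elim/last_ind: a => // a i IH; rewrite /run_word foldl_rcons /= -IH /add_lab.
by case: ifP => // _; rewrite !inE; case: eqP.
Qed.

(** The last label is removed by forgetting it in every box, which recovers the
    run of the preceding factors; the letters of the last factor are the
    columns containing it. *)
Lemma run_inj alpha beta : all_cyc alpha -> all_cyc beta -> size alpha = size beta ->
  labs (run alpha).2 = labs (run beta).2 -> alpha = beta.
Proof.
elim/last_ind: alpha beta => [|alpha v IH] beta; first by case: beta.
case/lastP: beta => [|beta v']; first by rewrite size_rcons.
move=> ca cb; rewrite !size_rcons => -[es] eL.
have [ca1 cv] := iffLR (all_cyc_rcons _ _) ca; have [cb1 cv'] := iffLR (all_cyc_rcons _ _) cb.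
have eab : alpha = beta.
  apply: IH => //; apply/funext => p; apply/funext => q; apply/fsetP => k.
  have [ek|/eqP nk] := eqVneq k (size alpha).+1.
    have [_ ba _] := run_valid ca1; have [_ bb _] := run_valid cb1.
    by rewrite ek; apply/idP/idP => [/ba|/bb]; rewrite ?es ltnn andbF.
  have := congr1 (fun L => k \in L p q) eL.
  by rewrite !run_rcons -es !run_word_old.
have [wa _ _] := run_valid ca; have [wb _ _] := run_valid cb.
have eS := labs_inj wa wb eL.
suff : cyc_word v =i cyc_word v'.
  have [c1 e1] := cyc_wordP cv; have [c2 e2] := cyc_wordP cv' => mem.
  rewrite eab; congr rcons; rewrite -e1 -e2 (word_perm_foldl (cyc_word v)) (word_perm_foldl (cyc_word v')).
  apply: (@foldl_comm n _ (fun w (i : 'Z_n) => w \o sgen i)) => // w i j n1 n2 n3.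
  exact: (congr1 (fun h => w \o h) (sgen_comm n_ge2 n1 n2 n3)).
move=> x; have := run_col ca (x + 1); have := run_col cb (x + 1).
rewrite eS es !addrK => h1 h2.
by apply/idP/idP => [/h2/h1|/h1/h2].
Qed.

Lemma run_surj t s : valid n t s -> exists alpha, [/\ all_cyc alpha, size alpha = t & (run alpha).2 = s].
Proof.
elim: t s => [|t IH] s.
  case=> ws bd _; exists [::]; split=> //.
  have [wi _ _] := id_valid n 0; apply: (labs_inj wi ws).
  apply/funext => p; apply/funext => q; apply/fsetP => k; rewrite inE.
  by apply/esym/negbTE/negP => /bd; lia.
move/(peel_word n_ge2) => [s0 [a [/IH[alpha [ca sa ea]] cwa ew]]].
pose v := word_perm a.
have cv : cyc_decreasing n v by apply/(cyc_decreasing_word_perm n_ge2); exists a.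
have [c1 e1] := cyc_wordP cv.
exists (rcons alpha v); split; [by apply/all_cyc_rcons|by rewrite size_rcons sa|].
rewrite run_rcons ea sa -ew; apply: (@foldl_comm n _ (step t.+1)) => //.
  by move=> s1 i j; apply: step_comm.
exact: (cyc_letters n_ge2 c1 cwa e1).
Qed.

(** The representatives of factorizations modulo trailing identities. *)
Definition trimmed alpha := forall beta, alpha <> rcons beta id.

Lemma cyc_word_id : cyc_word id = [::].
Proof.
have c : cyc_decreasing n id by apply/(cyc_decreasing_word_perm n_ge2); exists [::].
by apply/nilP; rewrite /nilp size_cyc_word // lenE // ?inv_id //; apply: affine_id.
Qed.

Lemma run_trimmed alpha : all_cyc alpha ->
  exists beta, [/\ all_cyc beta, trimmed beta & (run beta).2 = (run alpha).2].
Proof.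
elim/last_ind: alpha => [_|alpha v IH].
  by exists [::]; split=> // -[].
move=> ca; have [/IH[beta [c1 c2 e]] cv] := iffLR (all_cyc_rcons _ _) ca.
have [ev|nv] := pselect (v = id).
  by exists beta; split=> //; rewrite e run_rcons ev cyc_word_id.
by exists (rcons alpha v); split=> // gamma /rcons_inj[_ /nv].
Qed.

Lemma trimmed_label alpha : all_cyc alpha -> trimmed alpha -> (0 < size alpha)%N ->
  exists p q, size alpha \in labs (run alpha).2 p q.
Proof.
case/lastP: alpha => // alpha v ca can _.
have [_ /cyc_wordP[_ ev]] := iffLR (all_cyc_rcons _ _) ca.
case ew : (cyc_word v) => [|l r].
  by have := can alpha; rewrite -ev ew.
have [p [q [h _]]] : has_col (size alpha).+1 (run (rcons alpha v)).2 (l + 1).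
  by apply/(run_col ca); rewrite addrK ew mem_head.
by exists p, q; rewrite size_rcons.
Qed.

(** The number of factors is the largest label in use. *)
Lemma trimmed_inj alpha beta : all_cyc alpha -> all_cyc beta -> trimmed alpha ->
  trimmed beta -> labs (run alpha).2 = labs (run beta).2 -> alpha = beta.
Proof.
move=> ca cb na nb eL; apply: run_inj => //.
suff H x y : all_cyc x -> all_cyc y -> trimmed x -> labs (run x).2 = labs (run y).2 ->
    (size x <= size y)%N.
  by apply/eqP; rewrite eqn_leq !H.
move=> cx cy nx e; case: (posnP (size x)) => [-> //|/(trimmed_label cx nx)[p [q]]].
by have [_ bd _] := run_valid cy; rewrite e => /bd/andP[].
Qed.

Section RunWeight.
Variables (R : Type) (idx : R) (op : Monoid.com_law idx).
Variables (f : {fset nat} -> R) (c : nat -> R).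
Hypothesis f0 : f fset0 = idx.
Hypothesis fS : forall t (X : {fset nat}), t \notin X -> f (t |` X)%fset = op (c t) (f X).

Lemma run_word_wt t s a : (0 < t)%N -> valid n t s -> (forall j : 'Z_n, ~ has_col t s j) ->
  cycw a -> wt n op f (labs (run_word t s a)) =
            op (wt n op f (labs s)) (\big[op/idx]_(j < size a) c t).
Proof.
move=> t0 vs nc; elim/last_ind: a => [|a l IH] ca; first by rewrite big_ord0 Monoid.mulm1.
have ad := run_word_addable n_ge2 t0 vs nc ca.
move: ca; rewrite cycw_rcons => /and3P[_ _ ca].
have [[ws _ _] _] := run_word_valid n_ge2 t0 vs nc ca.
rewrite /run_word foldl_rcons -/(run_word _ _ _) (wt_step n_ge2 (c := c t) ws f0); first last.
- by move=> p q _ adj; have [] := addable_adj q ad adj.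
- exact: fS.
by rewrite IH // size_rcons big_ord_recr /= Monoid.mulmC -Monoid.mulmA.
Qed.

Lemma run_wt alpha : all_cyc alpha -> wt n op f (labs (run alpha).2) =
  \big[op/idx]_(i < size alpha) \big[op/idx]_(j < len n (nth id alpha i)) c i.+1.
Proof.
elim/last_ind: alpha => [_|alpha v IH].
  by rewrite big_ord0 /wt fsbig1.
case/all_cyc_rcons => ca cv; have [ws bd bl] := run_valid ca; have [cw _] := cyc_wordP cv.
have v' : valid n (size alpha).+1 (run alpha).2 by split=> //; apply: boundedW.
rewrite run_rcons (run_word_wt _ v' (bounded_nocol bd)) // IH // size_rcons big_ord_recr /=.
rewrite nth_rcons ltnn eqxx size_cyc_word //; congr (op _ _).
by apply: eq_bigr => i _; rewrite nth_rcons ltn_ord.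
Qed.

End RunWeight.
End Runs.

(** * Products in the nilHecke algebra *)

Section NilHecke.
Variables (n : nat) (n_ge2 : (2 <= n)%N) (U : pzRingType) (u : (int -> int) -> U).
Hypothesis H : affine_nilHecke n u.
Implicit Types (s : state) (t : nat) (v w : int -> int) (i : 'Z_n) (a : seq 'Z_n).

Lemma nilHecke_inj w w' : affine_perm n w -> affine_perm n w' -> u w = u w' -> w = w'.
Proof.
move=> wA wA' e; apply: contrapT => ne.
have nw : (w' == w) = false by apply/eqP => /esym.
pose c v : int := if v == w then 1 else -1.
have : c w = 0; last by rewrite /c eqxx.
apply: (nilHecke_free H (ws := [:: w; w'])); last by rewrite mem_head.
- by rewrite /= inE andbT eq_sym nw.
- by move=> v; rewrite !inE => /orP[]/eqP->.
- by rewrite big_cons big_seq1 /c eqxx nw e mulr1z mulrN1z subrr.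
Qed.

(** The algebra is described by multiplication on the left; through reduced
    words it becomes a description of multiplication on the right. *)
Lemma u_reduced a : size a = ninv n (word_perm a) -> u (word_perm a) = \prod_(i <- a) u (sgen i).
Proof.
elim: a => [|i a IH] sa; first by rewrite big_nil; apply: nilHecke_one H.
have wA := word_perm_affine n_ge2 a.
have sa' : size a = ninv n (word_perm a).
  apply/eqP; rewrite eqn_leq inv_word_le // andbT leqNgt; apply/negP => lt.
  have [b [eb sb]] := ex_word n_ge2 wA.
  have := inv_word_le n_ge2 (i :: b); rewrite /= eb -[sgen i \o _]/(word_perm (i :: a)) -sa sb /=.
  lia.
rewrite big_cons -IH // (nilHecke_mul H) // !lenE //; last exact: (word_perm_affine n_ge2 (i :: a)).
by rewrite -[sgen i \o _]/(word_perm (i :: a)) -sa -sa' leqnn.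
Qed.

Lemma u_sq i : u (sgen i) * u (sgen i) = u (sgen i).
Proof.
have sA : affine_perm n (sgen i) by exact: (word_perm_affine n_ge2 [:: i]).
rewrite (nilHecke_mul H) //.
have -> : sgen i \o sgen i = id by apply/funext => x /=; rewrite sgenK.
by rewrite [len n id]lenE ?inv_id //; apply: affine_id.
Qed.

Lemma u_ascent w i : affine_perm n w -> ascent i w -> u w * u (sgen i) = u (w \o sgen i).
Proof.
move=> wA up; have [a [ea sa]] := ex_word n_ge2 wA.
have e : word_perm (rcons a i) = w \o sgen i by rewrite word_perm_rcons ea.
rewrite -e u_reduced; last by rewrite e inv_up // size_rcons sa.
by rewrite big_rcons /= -u_reduced ea.
Qed.

(** At a descent w is a shorter element times s_i, and u_i is idempotent. *)
Lemma u_step t s i : wf n s -> u (perm_of (step t s i)) = u (perm_of s) * u (sgen i).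
Proof.
move=> ws; have wA := wf_aff ws; rewrite /=; case: ifP => [up|/negbT dn].
  by rewrite u_ascent.
have wA' : affine_perm n (perm_of s \o sgen i) by apply: affine_sgen.
have up : ascent i (perm_of s \o sgen i) by rewrite ascent_sgen.
by have := u_ascent wA' up; rewrite sgenKf // => <-; rewrite -mulrA u_sq.
Qed.

Lemma u_run_word t s a : wf n s ->
  u (perm_of (run_word t s a)) = u (perm_of s) * \prod_(i <- a) u (sgen i).
Proof.
move=> ws; elim/last_ind: a => [|a i IH]; first by rewrite big_nil mulr1.
have wr : wf n (run_word t s a).
  elim/last_ind: a {IH} => // a j IH; rewrite /run_word foldl_rcons; exact: step_wf.
by rewrite /run_word foldl_rcons -/(run_word _ _ _) u_step // IH big_rcons mulrA.
Qed.

Lemma u_run alpha : all_cyc n alpha -> u (perm_of (run n alpha).2) = \prod_(v <- alpha) u v.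
Proof.
elim/last_ind: alpha => [_|alpha v IH]; first by rewrite big_nil; apply: nilHecke_one H.
case/all_cyc_rcons => ca cv; have [ws _ _] := run_valid n_ge2 ca.
rewrite run_rcons u_run_word // IH // big_rcons; congr (_ * _).
have [cw e] := cyc_wordP n_ge2 cv; rewrite -u_reduced ?e //.
by have [_ <-] := run_id_word n_ge2 cw; rewrite e.
Qed.

End NilHecke.

(** * Equality of weights, finiteness and the theorem *)

Section Correspondence.
Variables (n : nat) (n_ge2 : (2 <= n)%N).
Implicit Types (alpha : seq (int -> int)) (w : int -> int).

Definition labelling_of alpha : labelling := lab_of (run n alpha).2.

Lemma fact_size_lab alpha : all_cyc n alpha ->
  fact_size n alpha = lab_size n (perm_of (run n alpha).2) (labelling_of alpha).
Proof.
move=> ca; have [ws _ _] := run_valid n_ge2 ca.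
pose f (X : {fset nat}) := #|` X|%N.
have f0 : f fset0 = 0%N by rewrite /f cardfs0.
rewrite /lab_size -(@wt_fund_diagram n n_ge2 _ _ addn f _ ws f0).
rewrite (@run_wt n n_ge2 _ _ addn f (fun=> 1%N) f0 _ _ ca); last first.
  by move=> t X tX; rewrite /f cardfsU1 tX.
rewrite /fact_size (big_nth id) big_mkord; apply: eq_bigr => i _.
by rewrite sum_nat_const card_ord muln1.
Qed.

Lemma fact_monom_lab alpha : all_cyc n alpha ->
  fact_monom n alpha = lab_monom n (perm_of (run n alpha).2) (labelling_of alpha).
Proof.
move=> ca; have [ws _ _] := run_valid n_ge2 ca.
pose f (X : {fset nat}) : {cmonom nat} := \big[mmul/mone]_(k <- X) xvar k.
have f0 : f fset0 = mone by rewrite /f big_seq_fset0.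
rewrite /lab_monom -(@wt_fund_diagram n n_ge2 _ _ (@mmul {cmonom nat}) f _ ws f0).
rewrite (@run_wt n n_ge2 _ _ (@mmul {cmonom nat}) f xvar f0 _ _ ca) //.
by move=> t X tX; rewrite /f big_fsetU1.
Qed.

Lemma fact_term_lab w alpha : all_cyc n alpha -> perm_of (run n alpha).2 = w ->
  fact_term n w alpha = lab_term n w (labelling_of alpha).
Proof.
by move=> ca ew; rewrite /fact_term /lab_term fact_size_lab // fact_monom_lab // ew.
Qed.

(** The variable of the last factor occurs in the monomial. *)
Lemma fact_size_bound alpha : all_cyc n alpha -> trimmed alpha ->
  (size alpha <= \max_(k <- finsupp (fact_monom n alpha)) k)%N.
Proof.
case/lastP: alpha => [|alpha v] ca can; first by [].
have [_ cv] := iffLR (all_cyc_rcons _ _ _) ca.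
have lv : (0 < len n v)%N.
  rewrite -size_cyc_word //; have [_ ev] := cyc_wordP n_ge2 cv.
  by case e : (cyc_word n v) ev => // ev; case: (can alpha); rewrite -ev.
suff h : (size alpha).+1 \in finsupp (fact_monom n (rcons alpha v)).
  rewrite size_rcons.
  exact: (@leq_bigmax_seq _ (enum_fset _) xpredT id _ h isT).
rewrite mem_finsupp /fact_monom size_rcons big_ord_recr /= nth_rcons ltnn eqxx.
case: (len n v) lv => // l _; rewrite big_ord_recl /= !cmM.
by rewrite /xvar cmU eqxx -lt0n !addnS.
Qed.

(** Cyclically decreasing words have no repeated letters, so there are finitely
    many of them. *)
Lemma finite_bounded_facts (N : nat) :
  finite_set [set alpha | all_cyc n alpha /\ (size alpha <= N)%N].
Proof.
pose M := #|{: 'Z_n}|.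
pose g (x : {bseq N of {bseq M of 'Z_n}}) := [seq word_perm (bseqval a) | a <- bseqval x].
have : finite_set [set g x | x in [set: {bseq N of {bseq M of 'Z_n}}]].
  by apply: finite_image; exact: finite_finset.
apply: sub_finite_set => alpha [ca sa].
have sM v : v \in alpha -> (size (@cyc_word n v) <= M)%N.
  move/ca/(cyc_wordP n_ge2) => [/cycw_uniq/card_uniqP <- _].
  exact: max_card.
pose h v : {bseq M of 'Z_n} := insub_bseq M (@cyc_word n v).
exists (Bseq (leq_trans (eq_leq (size_map h alpha)) sa)) => //.
rewrite /g /= -map_comp map_id_in // => v va /=.
rewrite /insub_bseq insubdK; last exact: sM.
by have [] := cyc_wordP n_ge2 (ca _ va).
Qed.

End Correspondence.

Theorem theorem3p13 (n : nat) (n_ge2 : (2 <= n)%N)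
    (U : pzRingType) (u : (int -> int) -> U) (nilHecke_u : affine_nilHecke n u)
    (w : int -> int) (w_aff : affine_perm n w) :
  [/\ fps_summable (cyc_dec_factorization n u w) (fact_term n w),
      fps_summable (balanced_labelling n w) (lab_term n w) &
      Gtilde n u w = fps_sum (balanced_labelling n w) (lab_term n w)].
Proof.
set A := cyc_dec_factorization n u w; set B := balanced_labelling n w.
have AE alpha : A alpha <->
    [/\ all_cyc n alpha, trimmed alpha & perm_of (run n alpha).2 = w].
  split=> [[ca eu can]|[ca can ew]]; split=> //; last by rewrite -(u_run n_ge2 nilHecke_u ca) ew.
  have [ws _ _] := run_valid n_ge2 ca.
  apply: (nilHecke_inj nilHecke_u (wf_aff ws) w_aff).
  by rewrite (u_run n_ge2 nilHecke_u ca).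
have bij : set_bij A B (labelling_of n).
  split.
  - move=> alpha /AE[ca _ ew]; rewrite /B -ew.
    exact: (valid_labelling n_ge2 (run_valid n_ge2 ca)).
  - move=> alpha beta; rewrite !inE => /AE[ca na ea] /AE[cb nb eb] eL.
    apply: (trimmed_inj n_ge2 ca cb na nb); apply/funext => p; apply/funext => q.
    have [wa _ _] := run_valid n_ge2 ca.
    have := congr1 (fun T : labelling => T (pos_of (run n alpha).2 q, p)) eL.
    by rewrite /labelling_of /lab_of /= eb -ea (wf_K' wa).
  - move=> T BT; have [s [t [vs es eT]]] := labelling_valid n_ge2 w_aff BT.
    have [alpha [ca _ ea]] := run_surj n_ge2 vs.
    have [beta [cb nb eb]] := run_trimmed n_ge2 ca.
    exists beta; first by apply/AE; split=> //; rewrite eb ea.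
    by rewrite /labelling_of eb ea.
have term alpha : A alpha -> lab_term n w (labelling_of n alpha) = fact_term n w alpha.
  by case/AE => ca _ ew; rewrite (fact_term_lab n_ge2 ca ew).
have sumA : fps_summable A (fact_term n w).
  move=> m; apply: sub_finite_set (finite_bounded_facts n_ge2 (\max_(k <- finsupp m) k)).
  move=> alpha [/AE[ca na _]]; rewrite /fact_term /fps_monom.
  case: ifP => [/eqP em _|_]; last by rewrite eqxx.
  by split=> //; rewrite em; apply: fact_size_bound.
split=> //.
- move=> m; apply: sub_finite_set (finite_image (labelling_of n) (sumA m)).
  move=> T [/(set_bij_surj bij)[alpha Aa <-]]; rewrite term // => ne.
  by exists alpha.
- apply/funext => m; rewrite /Gtilde /fps_sum (reindex_fsbig (labelling_of n) A) //.
  by apply: eq_fsbigr => alpha; rewrite inE => /term->.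
Qed.
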